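(* Let $n\in\mathbb{N}$. Then $n\in S_3$ if and only if $$n=2^{2k+1}\left(8p+2\left\lfloor\frac{i}{2}\right\rfloor+3+2(-1)^{i}t_{p}\right)+i$$ for some $i\in\{0,1,2,3\}$, $k\in\mathbb{N}_+$ and $p\in\mathbb{N}$.
   Context: $\mathbb{N}$ is the set of non-negative integers and $\mathbb{N}_+$ the set of positive integers. For $m\in\mathbb{N}_+$, $b_m(n)$ is the number of partitions of $n$ into powers of two where each part has one of $m$ colors, i.e. $\sum_{n\ge 0} b_m(n)x^n=\prod_{j\ge 0}(1-x^{2^j})^{-m}$. The set $S_m$ is $S_m=\{n\in\mathbb{N}: b_m(n)\neq x^2+y^2+z^2\text{ for any }x,y,z\in\mathbb{Z}\}$. The Prouhet-Thue-Morse sequence is $t_n=(-1)^{s_2(n)}$, where $s_2(n)$ is the number of digits $1$ in the binary expansion of $n$. *)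

(* Defs.v *)
From mathcomp Require Import all_boot all_order all_algebra.

Set Implicit Arguments.
Unset Strict Implicit.
Unset Printing Implicit Defensive.

Import GRing.Theory Num.Theory.

Local Open Scope nat_scope.

(* A partition of n into powers of two, each part having one of m colors, is
   given by its multiplicities: c (i, j) is the number of parts equal to 2 ^ j
   of color i. Since j < 2 ^ j, the bounds j <= n and c (i, j) <= n built into
   the types exclude no partition, so b m n is the coefficient of x ^ n in
   \prod_(j >= 0) (1 - x ^ (2 ^ j)) ^ (- m). *)
Definition colored_binary_partitions (m n : nat) :
    {set {ffun 'I_m * 'I_n.+1 -> 'I_n.+1}} :=
  [set c : {ffun 'I_m * 'I_n.+1 -> 'I_n.+1} |
     \sum_(ij : 'I_m * 'I_n.+1) c ij * 2 ^ ij.2 == n].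

Definition b (m n : nat) : nat := #|colored_binary_partitions m n|.

Definition in_S (m n : nat) : Prop :=
  ~ exists x y z : int, ((b m n)%:Z = x ^+ 2 + y ^+ 2 + z ^+ 2)%R.

(* The binary digit of n at position j is odd (n %/ 2 ^ j), which is 0 for
   j >= n because n < 2 ^ n. *)
Definition s2 (n : nat) : nat := \sum_(j < n) odd (n %/ 2 ^ j).

Definition t (n : nat) : int := ((-1) ^+ s2 n)%R.

(* Main.v *)
(* Let B(x) be the generating function of b_3, so (1 - x)^3 B(x) = B(x^2), and
   let T(x) be that of the Thue-Morse sequence, so T(x) = (1 - x) T(x^2).
   Modulo 32, B(x) = (1 - x)^4 (T(x) + 8 M(x)), where
   M(x) = (1 - x) (M(x^2) + x T(x^2) / (1 + x^2)): both sides satisfy the same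
   functional equation because (1 + x)^4 - (1 - x)^4 = 8 x (1 + x^2) and
   (1 - x)^4 = (1 + x^2)^2 modulo 4.  For n = 4 * 2^v * (2 l + 1) + i with i < 4
   this gives b_3(n) = 2 modulo 4 when v is even, and when v is odd it gives
   b_3(n) / 4 modulo 8 as a function of i, t_l and the parity of l, with values
   in {1, 3, 5, 7}.  By the three-square theorem n lies in S_3 exactly when the
   last value is 7.

   The three-square theorem is obtained by counting: r_3(m) is the sum of w over
   the solutions of x y + y z + z x = m in nonnegative integers, where w is up to
   sign 4, 2 or 0 according to the number of zeros, the sign being negative when
   x, y, z have the same parity.  Since sum_s r_3(n - s^2) = r_4(n) determines
   r_3, it is enough to sum w over x y + y z + z x + s^2 = n.  A pointwise
   identity writes w as a combination of terms that cancel under involutions of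
   this quadric and of terms supported on hyperplanes, whose sums are divisor
   sums.  Jacobi's formula for r_4 follows in turn from the recurrence
   sum_s (n - 5 s^2) r_4(n - s^2) = 0, verified for the divisor sum by
   Liouville's method. *)

Require Import Defs.
From HB Require Import structures.
From mathcomp Require Import all_boot all_order all_algebra.
From Stdlib Require Import ZArith Lia.

(* ZArith has bound the key N to its own scope. *)
Delimit Scope nat_scope with N.

Set Implicit Arguments.
Unset Strict Implicit.
Unset Printing Implicit Defensive.

Import GRing.Theory.

#[local] Arguments Z.add : simpl never.
#[local] Arguments Z.sub : simpl never.
#[local] Arguments Z.mul : simpl never.
#[local] Arguments Z.opp : simpl never.
#[local] Arguments Z.of_nat : simpl never.

(** * The pointwise identity *)

Section Pointwise.

Local Open Scope Z_scope.

(** Nonzero only when [a * d] and [- (b * c)] are both positive, which bounds the four entries once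
    [a * d - b * c] is fixed. *)
Definition cross (a b c d : Z) : Z :=
  if (0 <? Z.sgn a * Z.sgn d) && (Z.sgn b * Z.sgn c <? 0)
  then Z.sgn a * Z.sgn c else 0.

Definition crossX (x y z s : Z) : Z := cross (s - x) (x + z) (- (s + y)) (s - z).

Definition crossY (x y z s : Z) : Z :=
  if (0 <? Z.sgn (s + z) * Z.sgn (s - z)) && (0 <? Z.sgn (x + z) * Z.sgn (y + z))
  then Z.sgn z * Z.sgn (x + z) else 0.

(** Tests the sign of [a], so that the identity below depends on its linear forms only through
    signs. *)
Definition on (a w : Z) : Z := if Z.sgn a =? 0 then w else 0.

(** An indicator with half weight on the boundary: 2 for equal nonzero signs, 1 if an argument
    vanishes, 0 for opposite signs. *)
Definition btw (a c : Z) : Z := 1 + Z.sgn a * Z.sgn c.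

Definition wt (x y z : Z) : Z :=
  match Z.sgn x, Z.sgn y, Z.sgn z with
  | 1, 1, 1 => 4
  | 0, 1, 1 | 1, 0, 1 | 1, 1, 0 => 2
  | _, _, _ => 0
  end.

Definition origin (x y z : Z) : Z := on x (on y (on z 1)).

Lemma sgn_minor a b c d n p q : 0 < n -> a * b + c * d = n ->
  p = Z.sgn a * Z.sgn b -> q = Z.sgn c * Z.sgn d -> (0 <? p) || (0 <? q) = true.
Proof. by move=> n0 E -> ->; rewrite -!Z.sgn_mul; lia. Qed.

Definition sgn_cases (t e : Z) : Prop :=
  (e = -1 /\ t < 0) \/ (e = 0 /\ t = 0) \/ (e = 1 /\ 0 < t).

Lemma sgn_casesP t : sgn_cases t (Z.sgn t).
Proof. by rewrite /sgn_cases; lia. Qed.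

Ltac split_sgn H :=
  destruct H as [[-> H]|[[-> H]|[-> H]]];
  try (exfalso; discriminate); try (exfalso; lia).

Ltac abstract_sgn t e H :=
  pose proof (sgn_casesP t) as H; generalize dependent (Z.sgn t); intros e; intros.

(* Each M_i below says that a minor equal to n > 0 has a positive term; this rules
   out enough sign patterns of the fifteen linear forms for the remaining ones to
   be checked by computation. *)
Lemma crossing_identity x y z s : 0 < x * y + y * z + z * x + s * s ->
  wt x y z + wt (- x) (- y) (- z) + origin x y z =
  2 * crossX x y z s + 2 * crossX x y z (- s)
  + 2 * crossY x y z s + 2 * crossY y z x s + 2 * crossY z x y s
  + on (s - x) (btw x (z - x)) + on (s + x) (btw x (z - x))
  + on (s - z) (btw z (x - z)) + on (s + z) (btw z (x - z))
  + on (s - y) (btw y (x + z)) + on (s + y) (btw y (x + z))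
  + on (y + z) (btw (z - x) (z + x)) + on (x + y) (btw (y - z) (y + z))
  + on (x + z) (btw (x - y) (x + y) - btw (s - y) (s + y)).
Proof.
intros Hn.
pose proof (sgn_minor (a := x + z) (b := y + z) (c := s - z) (d := s + z) Hn ltac:(ring) erefl erefl) as M1.
pose proof (sgn_minor (a := s + z) (b := s + y) (c := - (s - x)) (d := y + z) Hn ltac:(ring) erefl erefl) as M2.
pose proof (sgn_minor (a := s - x) (b := s - z) (c := x + z) (d := s + y) Hn ltac:(ring) erefl erefl) as M3.
pose proof (sgn_minor (a := s - z) (b := s - y) (c := y + z) (d := s + x) Hn ltac:(ring) erefl erefl) as M4.
pose proof (sgn_minor (a := y + z) (b := x + y) (c := s + y) (d := s - y) Hn ltac:(ring) erefl erefl) as M5.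
pose proof (sgn_minor (a := s + y) (b := s + x) (c := - (s - z)) (d := x + y) Hn ltac:(ring) erefl erefl) as M6.
pose proof (sgn_minor (a := s + x) (b := s + z) (c := - (s - y)) (d := x + z) Hn ltac:(ring) erefl erefl) as M7.
pose proof (sgn_minor (a := s - y) (b := s - x) (c := x + y) (d := s + z) Hn ltac:(ring) erefl erefl) as M8.
pose proof (sgn_minor (a := x + y) (b := x + z) (c := s - x) (d := s + x) Hn ltac:(ring) erefl erefl) as M9.
clear Hn.
unfold origin, crossX, crossY, cross, wt, btw, on.
(* Every linear form becomes plus or minus one of fifteen, so that each sign gets a single
   variable. *)
replace (- s - x) with (- (s + x)) by ring.
replace (- (- s + y)) with (s - y) by ring.
replace (- s - z) with (- (s + z)) by ring.
replace (- s + z) with (- (s - z)) by ring.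
replace (- s + x) with (- (s - x)) by ring.
replace (- s + y) with (- (s - y)) by ring.
replace (- s - y) with (- (s + y)) by ring.
replace (y + x) with (x + y) by ring.
replace (z + x) with (x + z) by ring.
replace (z + y) with (y + z) by ring.
replace (z - x) with (- (x - z)) by ring.
rewrite -> ?Z.sgn_opp in *.
abstract_sgn (x + z) su Su. abstract_sgn (y + z) sw Sw. abstract_sgn (x + y) sv Sv.
abstract_sgn (s - x) sa1 Sa1. abstract_sgn (s + x) sa2 Sa2.
abstract_sgn (s - y) sb1 Sb1. abstract_sgn (s + y) sb2 Sb2.
abstract_sgn (s - z) sc1 Sc1. abstract_sgn (s + z) sc2 Sc2.
abstract_sgn (x - z) sxz Sxz. abstract_sgn (y - z) syz Syz. abstract_sgn (x - y) sxy Sxy.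
abstract_sgn x sx Sx. abstract_sgn y sy Sy. abstract_sgn z sz Sz.
(* The nine forms occurring in the minors come first, so that [M1] to [M9] and linear contradictions
   discard most patterns early. *)
split_sgn Su; split_sgn Sw; split_sgn Sv; split_sgn Sc1; split_sgn Sc2;
  split_sgn Sa1; split_sgn Sa2; split_sgn Sb1; split_sgn Sb2;
  split_sgn Sx; split_sgn Sy; split_sgn Sz;
  split_sgn Sxy; split_sgn Sxz; split_sgn Syz; vm_compute; reflexivity.
Qed.

End Pointwise.

(* Loaded only here: zify slows down the calls of lia in crossing_identity. *)
From mathcomp Require Import zify ssrZ.

HB.instance Definition _ :=
  Monoid.isComLaw.Build Z 0%Z Z.add Z.add_assoc Z.add_comm Z.add_0_l.

Notation "\sumZ_ ( i <- r ) F" := (\big[Z.add/0%Z]_(i <- r) F%Z)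
  (at level 41, i at level 50, F at level 41, format "\sumZ_ ( i  <-  r )  F") : Z_scope.

(** * Sums over boxes *)

Section BoxSums.

Local Open Scope Z_scope.

(** The maps have to be inverse to each other only where the summands are nonzero, so they may leave
    the box elsewhere. *)
Lemma sum_bij (T U : eqType) (S : seq T) (R : seq U) (F : T -> Z) (G : U -> Z)
    (h : T -> U) (k : U -> T) :
    uniq S -> uniq R ->
    (forall t, t \in S -> F t <> 0 -> [/\ h t \in R, k (h t) = t & G (h t) = F t]) ->
    (forall u, u \in R -> G u <> 0 -> [/\ k u \in S, h (k u) = u & F (k u) = G u]) ->
  \sumZ_(t <- S) F t = \sumZ_(u <- R) G u.
Proof.
move=> uS uR hS kR.
have nz (V : eqType) (A : seq V) (E : V -> Z) :
    \sumZ_(t <- A) E t = \sumZ_(t <- [seq t <- A | E t != 0]) E t.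
  by rewrite big_filter [RHS]big_mkcond; apply: eq_bigr => t _; case: eqP.
rewrite nz [RHS]nz.
have -> : \sumZ_(t <- [seq t <- S | F t != 0]) F t =
    \sumZ_(u <- map h [seq t <- S | F t != 0]) G u.
  rewrite big_map; apply: eq_big_seq => t.
  by rewrite mem_filter => /andP[/eqP Ft tS]; case: (hS t tS Ft).
apply: perm_big; apply: uniq_perm; last first.
- move=> u; rewrite mem_filter; apply/mapP/andP => [[t] | [/eqP Gu uR']].
    rewrite mem_filter => /andP[/eqP Ft tS] ->.
    by have [hR _ ->] := hS t tS Ft; split=> //; apply/eqP.
  have [kS hk Fk] := kR u uR' Gu; exists (k u) => //.
  by rewrite mem_filter kS andbT Fk; apply/eqP.
- exact: filter_uniq.
- rewrite map_inj_in_uniq ?filter_uniq // => t t'.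
  rewrite !mem_filter => /andP[/eqP Ft tS] /andP[/eqP Ft' tS'] E.
  by have [_ <- _] := hS t tS Ft; have [_ <- _] := hS t' tS' Ft'; rewrite E.
Qed.

Lemma sum_involution (T : eqType) (S : seq T) (F G : T -> Z) (h : T -> T) :
    uniq S ->
    (forall t, t \in S -> F t <> 0 -> [/\ h t \in S, h (h t) = t & G (h t) = F t]) ->
    (forall t, t \in S -> G t <> 0 -> [/\ h t \in S, h (h t) = t & F (h t) = G t]) ->
  \sumZ_(t <- S) F t = \sumZ_(t <- S) G t.
Proof. by move=> uS hF hG; apply: (sum_bij (h := h) (k := h)). Qed.

(** The sum equals its own opposite; a fixed point of [h] can only carry the value 0. *)
Lemma sum_antisym (T : eqType) (S : seq T) (F : T -> Z) (h : T -> T) :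
    uniq S ->
    (forall t, t \in S -> F t <> 0 -> [/\ h t \in S, h (h t) = t & F (h t) = - F t]) ->
  \sumZ_(t <- S) F t = 0.
Proof.
move=> uS hF.
have : \sumZ_(t <- S) F t = \sumZ_(t <- S) - F t.
  apply: (sum_involution (h := h)) => // t tS Ft.
    by have [? ? E] := hF t tS Ft; split=> //; rewrite E; lia.
  have Ft' : F t <> 0 by lia.
  by have [? ? E] := hF t tS Ft'; split=> //.
have -> : \sumZ_(t <- S) - F t = - \sumZ_(t <- S) F t.
  by elim: (S) => [|a S' IH]; rewrite ?big_nil // !big_cons IH; lia.
by lia.
Qed.

Definition rg (B : nat) : seq Z :=
  [seq Z.of_nat i - Z.of_nat B | i <- iota 0 (B.*2.+1)].

Lemma mem_rg B x : (x \in rg B) = (Z.abs x <=? Z.of_nat B).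
Proof.
apply/mapP/idP => [[i] | H].
  by rewrite mem_iota => ? ->; lia.
by exists (Z.to_nat (x + Z.of_nat B)); [rewrite mem_iota|]; lia.
Qed.

Lemma rg_uniq B : uniq (rg B).
Proof. by rewrite map_inj_uniq ?iota_uniq // => i j; lia. Qed.

Definition box2 B : seq (Z * Z) := [seq (x, y) | x <- rg B, y <- rg B].
Definition box3 B : seq (Z * Z * Z) := [seq (p, z) | p <- box2 B, z <- rg B].
Definition box4 B : seq (Z * Z * Z * Z) := [seq (p, s) | p <- box3 B, s <- rg B].

Lemma mem_pairs (T U : eqType) (S : seq T) (R : seq U) x y :
  ((x, y) \in [seq (a, c) | a <- S, c <- R]) = (x \in S) && (y \in R).
Proof.
apply/allpairsP/andP => [[[a c] /= [? ? [-> ->]]] // | [? ?]].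
by exists (x, y).
Qed.

Lemma pairs_uniq (T U : eqType) (S : seq T) (R : seq U) :
  uniq S -> uniq R -> uniq [seq (a, c) | a <- S, c <- R].
Proof. by move=> uS uR; apply: allpairs_uniq => // -[? ?] [? ?]. Qed.

Lemma box2_uniq B : uniq (box2 B). Proof. by rewrite pairs_uniq ?rg_uniq. Qed.
Lemma box3_uniq B : uniq (box3 B). Proof. by rewrite pairs_uniq ?rg_uniq ?box2_uniq. Qed.
Lemma box4_uniq B : uniq (box4 B). Proof. by rewrite pairs_uniq ?rg_uniq ?box3_uniq. Qed.

Lemma sum_box2 B (F : Z * Z -> Z) :
  \sumZ_(t <- box2 B) F t = \sumZ_(x <- rg B) \sumZ_(y <- rg B) F (x, y).
Proof. exact: big_allpairs. Qed.

Lemma sum_box3 B (F : Z * Z * Z -> Z) :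
  \sumZ_(t <- box3 B) F t =
  \sumZ_(x <- rg B) \sumZ_(y <- rg B) \sumZ_(z <- rg B) F (x, y, z).
Proof. by rewrite /box3 big_allpairs sum_box2. Qed.

Lemma sum_box4 B (F : Z * Z * Z * Z -> Z) :
  \sumZ_(t <- box4 B) F t = \sumZ_(x <- rg B) \sumZ_(y <- rg B)
    \sumZ_(z <- rg B) \sumZ_(s <- rg B) F (x, y, z, s).
Proof. by rewrite /box4 big_allpairs sum_box3. Qed.

End BoxSums.

(** * Representations by squares *)

Section FourSquares.

Local Open Scope Z_scope.

(* The number of representations of n by k squares of integers in [-B, B]; this is
   the full r_k(n) once n <= B. *)
Fixpoint sqcount (B k : nat) (n : Z) : Z :=
  if k is k'.+1 then \sumZ_(s <- rg B) sqcount B k' (n - s * s)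
  else if n =? 0 then 1 else 0.

Lemma sumZD (T : Type) (S : seq T) (F G : T -> Z) :
  \sumZ_(t <- S) (F t + G t) = \sumZ_(t <- S) F t + \sumZ_(t <- S) G t.
Proof. exact: big_split. Qed.

Lemma sumZM (T : Type) (S : seq T) (c : Z) (F : T -> Z) :
  \sumZ_(t <- S) c * F t = c * \sumZ_(t <- S) F t.
Proof.
by elim: S => [|a S IH]; rewrite ?big_nil ?big_cons; [lia | rewrite IH; lia].
Qed.

Lemma sumZN (T : Type) (S : seq T) (F : T -> Z) :
  \sumZ_(t <- S) - F t = - \sumZ_(t <- S) F t.
Proof.
by elim: S => [|a S IH]; rewrite ?big_nil // !big_cons IH; lia.
Qed.

Lemma sumZ0 (T : eqType) (S : seq T) (F : T -> Z) :
  (forall t, t \in S -> F t = 0) -> \sumZ_(t <- S) F t = 0.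
Proof. by move=> F0; rewrite big_seq big1. Qed.

Lemma sumZ_ge0 (T : eqType) (S : seq T) (F : T -> Z) :
  (forall t, t \in S -> 0 <= F t) -> 0 <= \sumZ_(t <- S) F t.
Proof.
elim: S => [|a S IH] F0; first by rewrite big_nil.
rewrite big_cons; have := F0 a (mem_head _ _).
have := IH (fun t tS => F0 t (mem_behead (s := a :: S) tS)).
move: (\sumZ_(t <- S) F t) => c; lia.
Qed.

Lemma sumZ_gt0 (T : eqType) (S : seq T) (F : T -> Z) :
  0 < \sumZ_(t <- S) F t -> exists2 t, t \in S & 0 < F t.
Proof.
elim: S => [|a S IH]; first by rewrite big_nil.
rewrite big_cons; case: (Z.ltb_spec 0 (F a)) => [Fa _|Fa].
  by exists a; rewrite ?mem_head.
move=> H; case: IH => [|t tS Ft].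
  by move: H; move: (\sumZ_(t <- S) F t) => c; lia.
by exists t; rewrite // inE tS orbT.
Qed.

Lemma sumZ_delta (B : nat) (F : Z -> Z) (a : Z) : Z.abs a <= Z.of_nat B ->
  (forall s, s <> a -> F s = 0) -> \sumZ_(s <- rg B) F s = F a.
Proof.
move=> aB F0.
have -> : \sumZ_(s <- rg B) F s = F a + \sumZ_(s <- rem a (rg B)) F s.
  by apply: big_rem; rewrite mem_rg; lia.
rewrite sumZ0; first by lia.
by move=> s; rewrite mem_rem_uniq ?rg_uniq // inE => /andP[/eqP sa _]; apply: F0.
Qed.

Lemma sumZ_opp (B : nat) (F : Z -> Z) :
  \sumZ_(s <- rg B) F (- s) = \sumZ_(s <- rg B) F s.
Proof.
apply: (sum_bij (h := Z.opp) (k := Z.opp)); rewrite ?rg_uniq // => s;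
  rewrite !mem_rg => ? _; split; rewrite ?mem_rg ?Z.opp_involutive //; lia.
Qed.

Lemma sumZ_odd (B : nat) (F : Z -> Z) :
  (forall s, F (- s) = - F s) -> \sumZ_(s <- rg B) F s = 0.
Proof.
move=> Fo; have := sumZ_opp B F.
have -> : \sumZ_(s <- rg B) F (- s) = - \sumZ_(s <- rg B) F s.
  by rewrite -sumZN; apply: eq_bigr => s _; rewrite Fo.
by move: (\sumZ_(s <- rg B) F s) => c; lia.
Qed.

Lemma sqcount_neg B k n : n < 0 -> sqcount B k n = 0.
Proof.
elim: k n => [|k IH] n n0 /=; first by case: ifP => //; lia.
by apply: sumZ0 => s _; apply: IH; nia.
Qed.

Lemma sqcount_0 B k : sqcount B k 0 = 1.
Proof.
elim: k => [//|k IH] /=; rewrite (sumZ_delta (a := 0)) //; first by lia.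
by move=> s s0; apply: sqcount_neg; nia.
Qed.

(* The derivative of the (k+1)-st power of the theta series. *)
Lemma sqcount_deriv B k n : n * sqcount B k.+1 n =
  Z.of_nat k.+1 * \sumZ_(s <- rg B) s * s * sqcount B k (n - s * s).
Proof.
elim: k n => [|k IH] n.
  rewrite -!sumZM; apply: eq_bigr => s _.
  by rewrite [sqcount _ _ _]/=; case: ifP => H; lia.
(* Split n as s^2 + (n - s^2). The induction hypothesis and an exchange of summations turn the
   second part into k + 1 copies of the first. *)
have -> : n * sqcount B k.+2 n = \sumZ_(s <- rg B) (s * s * sqcount B k.+1 (n - s * s)
    + (n - s * s) * sqcount B k.+1 (n - s * s)).
  rewrite -[sqcount B k.+2 n]/(\sumZ_(s <- rg B) sqcount B k.+1 (n - s * s)) -sumZM.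
  by apply: eq_bigr => s _; rewrite -Z.mul_add_distr_r; congr (_ * _); lia.
rewrite sumZD.
have -> : \sumZ_(s <- rg B) (n - s * s) * sqcount B k.+1 (n - s * s) =
    Z.of_nat k.+1 * \sumZ_(j <- rg B) j * j * sqcount B k.+1 (n - j * j).
  under eq_bigr => s _ do rewrite IH.
  rewrite sumZM; congr (_ * _).
  transitivity (\sumZ_(s <- rg B) \sumZ_(j <- rg B) j * j * sqcount B k (n - j * j - s * s)).
    by apply: eq_bigr => s _; apply: eq_bigr => j _; congr (_ * sqcount B k _); lia.
  by rewrite exchange_big; apply: eq_bigr => j _; rewrite sumZM.
by move: (\sumZ_(s <- rg B) _) => c; lia.
Qed.

(** Here r_5(n) is written in two ways through r_4: by its definition, and by n r_5(n) = 5 sum_s s^2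
    r_4(n - s^2). *)
Lemma sqcount4_rec B n :
  \sumZ_(s <- rg B) (n - 5 * (s * s)) * sqcount B 4 (n - s * s) = 0.
Proof.
have := sqcount_deriv B 4 n.
have -> : n * sqcount B 5 n = \sumZ_(s <- rg B) n * sqcount B 4 (n - s * s).
  by rewrite sumZM.
rewrite -sumZM => E.
under eq_bigr => s _ do rewrite Z.mul_sub_distr_r -Z.add_opp_r.
rewrite sumZD E sumZN.
have -> : \sumZ_(i <- rg B) 5 * (i * i) * sqcount B 4 (n - i * i) =
   \sumZ_(i <- rg B) Z.of_nat 5 * (i * i * sqcount B 4 (n - i * i)).
  by apply: eq_bigr => s _; move: (sqcount _ _ _) => c; lia.
by move: (\sumZ_(s <- rg B) _) => c; lia.
Qed.

End FourSquares.

(** * Jacobi's four-square formula *)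

Section Jacobi.

Local Open Scope Z_scope.

Definition parity_sign2 (d e : Z) : Z := if Z.even d && Z.even e then -1 else 1.

Definition divsum (B : nat) (n : Z) : Z :=
  \sumZ_(t <- box2 B) if [&& 0 <? t.1, 0 <? t.2 & t.1 * t.2 =? n]
    then parity_sign2 t.1 t.2 * t.2 else 0.

(* Subtracting instead of adding e when d and e are even makes divsum B n the sum
   of the divisors of n that are not multiples of 4. *)
Definition jacobi4 (B : nat) (n : Z) : Z := 8 * divsum B n + (if n =? 0 then 1 else 0).

Lemma mem_box3 B x y z : ((x, y, z) \in box3 B) =
  [&& Z.abs x <=? Z.of_nat B, Z.abs y <=? Z.of_nat B & Z.abs z <=? Z.of_nat B].
Proof. by rewrite !mem_pairs !mem_rg andbA. Qed.

Lemma mem_box4 B x y z s : ((x, y, z, s) \in box4 B) =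
  [&& Z.abs x <=? Z.of_nat B, Z.abs y <=? Z.of_nat B,
      Z.abs z <=? Z.of_nat B & Z.abs s <=? Z.of_nat B].
Proof. by rewrite !mem_pairs !mem_rg !andbA. Qed.

Lemma eq_sumZ (T : Type) (S : seq T) (F G : T -> Z) :
  (forall t, F t = G t) -> \sumZ_(t <- S) F t = \sumZ_(t <- S) G t.
Proof. by move=> FG; apply: eq_bigr => t _. Qed.

(** * Liouville's involutions on s^2 + d e = n *)

Section Reduction.

Variables (B : nat) (n : Z).
Hypotheses (n0 : 0 < n) (nB : n <= Z.of_nat B).

Let term (A : Z -> Z -> Z -> bool) (phi : Z -> Z -> Z -> Z) (t : Z * Z * Z) : Z :=
  let: (s, d, e) := t in
  if [&& 0 <? d, 0 <? e, s * s + d * e =? n & A s d e]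
  then parity_sign2 d e * phi s d e else 0.

Let total A phi := \sumZ_(t <- box3 B) term A phi t.

Let all3 (s d e : Z) := true.
Let above (s d e : Z) := 2 * s + e <? d.
Let below (s d e : Z) := d <? 2 * s + e.
Let wall (s d e : Z) := d =? 2 * s + e.
(* K is odd under the involution (s, d, e) |-> (- s - e, d - 2 s - e, e) of the
   region above the wall d = 2 s + e, while Q is odd in s. *)
Let P s d e := (d + e) * (d * e - 4 * (s * s)).
Let Q s d e := 2 * s * (d * d - e * e).
Let K s d e := P s d e + Q s d e.

Lemma term_bounds s d e : 0 < d -> 0 < e -> s * s + d * e = n ->
  [/\ Z.abs s <= Z.of_nat B, d <= Z.of_nat B & e <= Z.of_nat B].
Proof. by move=> *; split; nia. Qed.

(** Symmetrization under the exchange of d and e. *)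
Lemma total_P : 2 * total all3 (fun s d e => e * (d * e - 4 * (s * s))) = total all3 P.
Proof.
have -> : total all3 P = total all3 (fun s d e => d * (d * e - 4 * (s * s)))
    + total all3 (fun s d e => e * (d * e - 4 * (s * s))).
  rewrite -sumZD; apply: eq_sumZ => -[[s d] e] /=; case: ifP => _ //.
  by rewrite /P; ring.
suff -> : total all3 (fun s d e => d * (d * e - 4 * (s * s))) =
    total all3 (fun s d e => e * (d * e - 4 * (s * s))) by lia.
apply: (sum_involution (h := fun t => let: (s, d, e) := t in (s, e, d)));
  rewrite ?box3_uniq //.
all: move=> [[s d] e] /=; rewrite !mem_box3 => tB.
all: case: ifP => // /and4P[? ? ? _] _; split=> //; first by lia.
all: rewrite ifT; last by apply/and4P; split=> //; lia.
all: by rewrite /parity_sign2 andbC; congr (_ * _); lia.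
Qed.

Lemma total_Q : total all3 Q = 0.
Proof.
apply: (sum_antisym (h := fun t => let: (s, d, e) := t in (- s, d, e)));
  rewrite ?box3_uniq //.
move=> [[s d] e] /=; rewrite !mem_box3 => tB.
case: ifP => // /and4P[? ? ? _] _; split; [lia | by congr (_, _, _); lia |].
rewrite ifT; last by apply/and4P; split=> //; lia.
by rewrite /Q; ring.
Qed.

Lemma parity_sign2_shift s d e : parity_sign2 (d - 2 * s - e) e = parity_sign2 d e.
Proof.
rewrite /parity_sign2 !Z.even_sub Z.even_mul /=.
by case: (Z.even d); case: (Z.even e).
Qed.

Lemma total_above : total above K = 0.
Proof.
apply: (sum_antisym (h := fun t => let: (s, d, e) := t in (- s - e, d - 2 * s - e, e)));
  rewrite ?box3_uniq //.
move=> [[s d] e] /=; rewrite !mem_box3 => tB.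
case: ifP => // /and4P[d0 e0 E Asde] _; rewrite /above in Asde.
have E' : (- s - e) * (- s - e) + (d - 2 * s - e) * e = n by lia.
have [? ? ?] := @term_bounds _ (d - 2 * s - e) e ltac:(lia) ltac:(lia) E'.
split; [lia | by congr (_, _, _); lia |].
rewrite ifT; last by apply/and4P; rewrite /above; split=> //; lia.
by rewrite parity_sign2_shift /K /P /Q; move: (parity_sign2 d e) => c; ring.
Qed.

(** The map (s, d, e) |-> (- s, e, d) exchanges the two sides of the wall and preserves K. *)
Lemma total_below : total below K = total above K.
Proof.
apply: (sum_involution (h := fun t => let: (s, d, e) := t in (- s, e, d)));
  rewrite ?box3_uniq //.
all: move=> [[s d] e] /=; rewrite !mem_box3 => tB.
all: case: ifP => // /and4P[? ? ? A'] _; rewrite /above /below in A'.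
all: split; [lia | by congr (_, _, _); lia |].
all: rewrite ifT; last by apply/and4P; rewrite /above /below; split=> //; lia.
all: by rewrite /parity_sign2 andbC; congr (_ * _); rewrite /K /P /Q; ring.
Qed.

(** Adding Q, whose total is 0, changes nothing; K then cancels on both sides of the wall. *)
Lemma total_wall_eq : total all3 P = total wall K.
Proof.
have -> : total all3 P = total all3 K.
  have -> : total all3 K = total all3 P + total all3 Q.
    rewrite -sumZD; apply: eq_sumZ => -[[s d] e] /=; case: ifP => _ //.
    by rewrite /K; ring.
  by rewrite total_Q; lia.
have -> : total all3 K = total above K + (total below K + total wall K).
  rewrite -!sumZD; apply: eq_sumZ => -[[s d] e] /=.
  rewrite /above /below /wall /all3.
  case: (0 <? d); case: (0 <? e); case: (_ =? n) => //=.
  by case: Z.ltb_spec => ?; case: Z.ltb_spec => ?; case: Z.eqb_spec => ?; lia.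
by rewrite total_below total_above; lia.
Qed.

End Reduction.

Definition alt (k : Z) : Z := if Z.even k then 1 else -1.

Lemma altD a c : alt (a + c) = alt a * alt c.
Proof. by rewrite /alt Z.even_add; case: (Z.even a); case: (Z.even c). Qed.

Lemma altS a : alt (a + 1) = - alt a.
Proof. by rewrite altD /= /alt; case: (Z.even a). Qed.

Lemma altN a : alt (- a) = alt a.
Proof. by rewrite /alt Z.even_opp. Qed.

(** A closed form checked by induction on k. It is needed at k = 2 c - 1, where the sum is - c. *)
Lemma sum_alt_parabola (B : nat) (c : Z) (k : nat) : Z.of_nat k <= Z.of_nat B ->
  2 * (\sumZ_(e <- rg B)
        if (0 <? e) && (e <=? Z.of_nat k) then alt e * (e * (2 * c - e)) else 0) =
  - c + alt (Z.of_nat k) * ((2 * c + 1) * (Z.of_nat k + 1)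
      - (Z.of_nat k + 1) * (Z.of_nat k + 1) - c).
Proof.
elim: k => [|k IH] kB.
  rewrite sumZ0; last by move=> e _; rewrite ifF //; lia.
  by rewrite -[alt (Z.of_nat 0)]/1 -[Z.of_nat 0]/0; ring.
have -> : \sumZ_(e <- rg B)
    (if (0 <? e) && (e <=? Z.of_nat k.+1) then alt e * (e * (2 * c - e)) else 0) =
  \sumZ_(e <- rg B)
    (if (0 <? e) && (e <=? Z.of_nat k) then alt e * (e * (2 * c - e)) else 0) +
  \sumZ_(e <- rg B) (if e =? Z.of_nat k.+1 then alt e * (e * (2 * c - e)) else 0).
  rewrite -sumZD; apply: eq_sumZ => e.
  case: (Z.eqb_spec e (Z.of_nat k.+1)) => [->|ne].
    by rewrite ifT ?ifF; lia.
  have -> : (e <=? Z.of_nat k.+1) = (e <=? Z.of_nat k) by lia.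
  by rewrite Z.add_0_r.
rewrite Z.mul_add_distr_l IH; last lia.
rewrite (sumZ_delta (a := Z.of_nat k.+1)); [|lia|by move=> s; case: Z.eqb_spec].
rewrite Z.eqb_refl.
have -> : Z.of_nat k.+1 = Z.of_nat k + 1 by lia.
by rewrite altS; move: (alt _) => a; ring.
Qed.

Section Recurrence.

Variables (B : nat) (n : Z).
Hypotheses (n0 : 0 < n) (nB : n <= Z.of_nat B).

Definition sqrts : Z := \sumZ_(s <- rg B) if s * s =? n then 1 else 0.

Lemma sum_positive_sqrt :
  2 * (\sumZ_(c <- rg B) if (0 <? c) && (c * c =? n) then 1 else 0) = sqrts.
Proof.
have -> : sqrts = \sumZ_(c <- rg B) (if (0 <? c) && (c * c =? n) then 1 else 0) +
   \sumZ_(c <- rg B) (if (0 <? - c) && (- c * - c =? n) then 1 else 0).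
  rewrite -sumZD; apply: eq_sumZ => c.
  have -> : - c * - c = c * c by lia.
  case: Z.eqb_spec => [E|]; last by rewrite !andbF.
  by case: Z.ltb_spec => ?; case: Z.ltb_spec => ? //=; nia.
rewrite (sumZ_opp B (fun c => if (0 <? c) && (c * c =? n) then 1 else 0)).
by move: (\sumZ_(c <- _) _) => a; lia.
Qed.

(** On the wall n is the square of c = s + e, and the weight collapses to 2 c d e with d = 2 c - e.
    For each positive root c of n there remains an alternating sum over 0 < e < 2 c. *)
Lemma wall_sum :
  \sumZ_(t <- box3 B) (let: (s, d, e) := t in
    if [&& 0 <? d, 0 <? e, s * s + d * e =? n & d =? 2 * s + e]
    then parity_sign2 d e *
      ((d + e) * (d * e - 4 * (s * s)) + 2 * s * (d * d - e * e)) else 0) =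
  n * sqrts.
Proof.
transitivity (\sumZ_(t <- box2 B) (let: (c, e) := t in
    if [&& 0 <? c, c * c =? n, 0 <? e & e <? 2 * c]
    then 2 * c * (- alt e * (e * (2 * c - e))) else 0)).
  apply: (sum_bij (h := fun t => let: (s, d, e) := t in (s + e, e))
                  (k := fun t => let: (c, e) := t in (c - e, 2 * c - e, e)));
    rewrite ?box3_uniq ?box2_uniq //.
  - move=> [[s d] e]; rewrite mem_box3 mem_pairs !mem_rg => tB.
    case: ifP => // /and4P[d0 e0 E w] _; split.
    + by apply/andP; split; [nia | lia].
    + by congr (_, _, _); lia.
    rewrite ifT; last by apply/and4P; split; [lia|nia|lia|lia].
    have -> : d = 2 * s + e by lia.
    rewrite /parity_sign2 /alt Z.even_add Z.even_mul /=.
    by case: (Z.even e) => /=; ring.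
  move=> [c e]; rewrite mem_box3 mem_pairs !mem_rg => tB.
  case: ifP => // /and4P[c0 E e0 ec] _; split.
  + by apply/and3P; split; nia.
  + by congr (_, _); lia.
  rewrite ifT; last by apply/and4P; split; [lia|lia|nia|lia].
  rewrite /parity_sign2 /alt Z.even_sub Z.even_mul /=.
  by case: (Z.even e) => /=; ring.
rewrite sum_box2 -sum_positive_sqrt -!sumZM; apply: eq_sumZ => c.
case: (Z.ltb_spec 0 c) => c0 /=; last by rewrite sumZ0; lia.
case: Z.eqb_spec => E /=; last by rewrite sumZ0; lia.
have := @sum_alt_parabola B c (Z.to_nat (2 * c - 1)) ltac:(nia).
have -> : Z.of_nat (Z.to_nat (2 * c - 1)) = 2 * c - 1 by lia.
have -> : alt (2 * c - 1) = -1 by rewrite /alt Z.even_sub Z.even_mul.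
have -> : \sumZ_(y <- rg B)
    (if (0 <? y) && (y <? 2 * c) then 2 * c * (- alt y * (y * (2 * c - y))) else 0) =
   - (2 * c) * \sumZ_(y <- rg B)
    (if (0 <? y) && (y <=? 2 * c - 1) then alt y * (y * (2 * c - y)) else 0).
  rewrite -sumZM; apply: eq_sumZ => y.
  have -> : (y <? 2 * c) = (y <=? 2 * c - 1) by lia.
  by case: ifP => _; ring.
by move: (\sumZ_(y <- _) _) => a; nia.
Qed.

(** With n - s^2 = d e the factor n - 5 s^2 is d e - 4 s^2, so the divisor sums contribute 8 V,
    while the value at 0 contributes - 4 n for each square root of n. These cancel because 2 V = n
    [sqrts]. *)
Lemma jacobi4_rec :
  \sumZ_(s <- rg B) (n - 5 * (s * s)) * jacobi4 B (n - s * s) = 0.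
Proof.
pose V := \sumZ_(t <- box3 B) (let: (s, d, e) := t in
  if [&& 0 <? d, 0 <? e & s * s + d * e =? n]
  then parity_sign2 d e * (e * (d * e - 4 * (s * s))) else 0).
have V2 : 2 * V = n * sqrts.
  rewrite -wall_sum.
  transitivity (2 * (\sumZ_(t <- box3 B) let: (s, d, e) := t in
     if [&& 0 <? d, 0 <? e, s * s + d * e =? n & true]
     then parity_sign2 d e * (e * (d * e - 4 * (s * s))) else 0)).
    by congr (2 * _); apply: eq_sumZ => -[[s d] e]; rewrite andbT.
  exact: etrans (total_P B n) (total_wall_eq n0 nB).
have -> : \sumZ_(s <- rg B) (n - 5 * (s * s)) * jacobi4 B (n - s * s) =
    8 * V + - (4 * n) * sqrts.
  rewrite /V sum_box3 -!sumZM -sumZD; apply: eq_sumZ => s.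
  rewrite /jacobi4 /divsum sum_box2.
  rewrite Z.mul_add_distr_l; congr (_ + _); last first.
    case: Z.eqb_spec => E1; case: Z.eqb_spec => E2; lia.
  have -> (a : Z) : (n - 5 * (s * s)) * (8 * a) = 8 * ((n - 5 * (s * s)) * a) by ring.
  congr (8 * _); rewrite -sumZM; apply: eq_sumZ => d; rewrite -sumZM.
  apply: eq_sumZ => e /=.
  have -> : (d * e =? n - s * s) = (s * s + d * e =? n) by lia.
  case: ifP => [/and3P[_ _ /Z.eqb_spec <-]|_]; last by ring.
  by move: (parity_sign2 d e) => c; ring.
by lia.
Qed.

End Recurrence.

Lemma jacobi4_0 B : jacobi4 B 0 = 1.
Proof.
rewrite /jacobi4 /divsum sumZ0 // => -[d e] _ /=.
by rewrite ifF //; apply/negP => /and3P[? ? ?]; nia.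
Qed.

Lemma jacobi4_neg B n : n < 0 -> jacobi4 B n = 0.
Proof.
move=> n0; rewrite /jacobi4 /divsum sumZ0 => [|[d e] _] /=.
  by rewrite ifF; lia.
by rewrite ifF //; apply/negP => /and3P[? ? ?]; nia.
Qed.

(** The hypothesis for [n >= 0] includes negative [m], since the recurrences evaluate at n - s^2. *)
Lemma Z_lt_wf_ind (P : Z -> Prop) :
  (forall n, (forall m, m < n -> 0 <= n -> P m) -> P n) -> forall n, P n.
Proof.
move=> H n; have Pneg m : m < 0 -> P m by move=> ?; apply: H => ? ? ?; lia.
have [|n0] := Z.lt_ge_cases n 0; first exact: Pneg.
elim/(well_founded_induction (Z.lt_wf 0)): n n0 => n IH n0.
apply: H => m mn _; have [|m0] := Z.lt_ge_cases m 0; first exact: Pneg.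
by apply: IH.
Qed.

(** Both sides obey the same recurrence. By induction their difference survives only at s = 0, where
    its coefficient is n, which is nonzero. *)
Theorem four_squares_count B n : n <= Z.of_nat B -> sqcount B 4 n = jacobi4 B n.
Proof.
elim/Z_lt_wf_ind: n => n IH nB.
have [n0|[->|n0]] := Z.lt_trichotomy n 0.
- by rewrite sqcount_neg // jacobi4_neg.
- by rewrite sqcount_0 jacobi4_0.
have : \sumZ_(s <- rg B)
    (n - 5 * (s * s)) * (sqcount B 4 (n - s * s) - jacobi4 B (n - s * s)) = 0.
  transitivity (\sumZ_(s <- rg B) (n - 5 * (s * s)) * sqcount B 4 (n - s * s)
      + - \sumZ_(s <- rg B) (n - 5 * (s * s)) * jacobi4 B (n - s * s)).
    by rewrite -sumZN -sumZD; apply: eq_sumZ => s; ring.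
  by rewrite sqcount4_rec jacobi4_rec.
rewrite (sumZ_delta (a := 0)); [|lia|by move=> s s0; rewrite IH; nia].
have -> : n - 0 * 0 = n by lia.
by move: (sqcount B 4 n) (jacobi4 B n) => a c; nia.
Qed.

End Jacobi.

(** * Sums over the quadric *)

Section ClassSum.

Local Open Scope Z_scope.

Definition parity_sign3 (x y z : Z) : Z :=
  if Z.even (x - y) && Z.even (y - z) then -1 else 1.

(** For e > 0 the summand is sgn x + sgn (e - 2 x), because one of the two signs is always 1. The
    first part is odd; the second sum grows by 1 with e, as exactly one sign then rises by 1. *)
Lemma sum_btw B e : e <> 0 -> Z.abs e <= Z.of_nat B ->
  \sumZ_(x <- rg B) btw x (e - x - x) = Z.abs e.
Proof.
have sgn_step (k : nat) : Z.of_nat k <= Z.of_nat B ->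
    \sumZ_(x <- rg B) Z.sgn (Z.of_nat k - x - x) = Z.of_nat k.
  elim: k => [|k IH] kB.
    by rewrite sumZ_odd // => x; rewrite -Z.sgn_opp; congr (Z.sgn _); lia.
  have [m km] : exists m, 2 * m <= Z.of_nat k.+1 <= 2 * m + 1.
    exists (Z.of_nat k.+1 / 2).
    by have := Z.div_mod (Z.of_nat k.+1) 2; have := Z.mod_pos_bound (Z.of_nat k.+1) 2; lia.
  have -> : \sumZ_(x <- rg B) Z.sgn (Z.of_nat k.+1 - x - x) =
    \sumZ_(x <- rg B) Z.sgn (Z.of_nat k - x - x) +
    \sumZ_(x <- rg B) (if x =? m then 1 else 0).
    rewrite -sumZD; apply: eq_sumZ => x.
    by case: Z.eqb_spec => ?; lia.
  rewrite IH ?(sumZ_delta (a := m)) ?Z.eqb_refl; try lia.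
  by move=> s; case: Z.eqb_spec.
have pos (d : Z) : 0 < d -> d <= Z.of_nat B ->
    \sumZ_(x <- rg B) btw x (d - x - x) = d.
  move=> d0 dB.
  have -> : \sumZ_(x <- rg B) btw x (d - x - x) =
      \sumZ_(x <- rg B) Z.sgn x + \sumZ_(x <- rg B) Z.sgn (d - x - x).
    by rewrite -sumZD; apply: eq_sumZ => x; rewrite /btw; nia.
  rewrite sumZ_odd => [|x]; last by lia.
  by have := sgn_step (Z.to_nat d); rewrite Z2Nat.id; lia.
move=> e0 eB; case: (Z.lt_trichotomy e 0) => [en|[//|ep]]; last by rewrite pos; lia.
have -> : \sumZ_(x <- rg B) btw x (e - x - x) = \sumZ_(x <- rg B) btw (- x) (- e - - x - - x).
  by apply: eq_sumZ => x; rewrite /btw; lia.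
by rewrite (sumZ_opp B (fun x => btw x (- e - x - x))) pos; lia.
Qed.

(** For z > 0 the summand splits as in [sum_btw]. Raising z by one alters the sign at two
    neighbouring x, whose contributions cancel by alternation. *)
Lemma sum_alt_btw B z : Z.abs z <= Z.of_nat B ->
  \sumZ_(x <- rg B) alt (x + z) * btw (z - x) (z + x) = if z =? 0 then 1 else 0.
Proof.
have step (k : nat) : Z.of_nat k <= Z.of_nat B ->
    \sumZ_(x <- rg B) alt x * Z.sgn (Z.of_nat k - x) = 0.
  elim: k => [|k IH] kB.
    by rewrite sumZ_odd // => x; rewrite altN -Z.mul_opp_r -Z.sgn_opp; congr (_ * Z.sgn _); lia.
  have -> : \sumZ_(x <- rg B) alt x * Z.sgn (Z.of_nat k.+1 - x) =
    \sumZ_(x <- rg B) alt x * Z.sgn (Z.of_nat k - x) +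
    (\sumZ_(x <- rg B) (if x =? Z.of_nat k then alt x else 0) +
    \sumZ_(x <- rg B) (if x =? Z.of_nat k + 1 then alt x else 0)).
    rewrite -!sumZD; apply: eq_sumZ => x.
    by case: Z.eqb_spec => ?; case: Z.eqb_spec => ?; nia.
  rewrite IH; last lia.
  rewrite (sumZ_delta (a := Z.of_nat k)); [|lia|by move=> s; case: Z.eqb_spec].
  rewrite (sumZ_delta (a := Z.of_nat k + 1)); [|lia|by move=> s; case: Z.eqb_spec].
  by rewrite !Z.eqb_refl altS; lia.
have pos d : 0 < d -> d <= Z.of_nat B ->
    \sumZ_(x <- rg B) alt (x + d) * btw (d - x) (d + x) = 0.
  move=> d0 dB.
  have -> : \sumZ_(x <- rg B) alt (x + d) * btw (d - x) (d + x) =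
      alt d * (\sumZ_(x <- rg B) (alt x * Z.sgn (d - x)) +
               \sumZ_(x <- rg B) (alt (- x) * Z.sgn (d - - x))).
    rewrite -sumZD -sumZM; apply: eq_sumZ => x.
    rewrite altD altN /btw.
    have -> : 1 + Z.sgn (d - x) * Z.sgn (d + x) = Z.sgn (d - x) + Z.sgn (d - - x).
      by nia.
    by ring.
  rewrite (sumZ_opp B (fun x => alt x * Z.sgn (d - x))).
  have := step (Z.to_nat d); rewrite Z2Nat.id => [->|]; lia.
move=> zB; case: Z.eqb_spec => [->|z0].
  rewrite (sumZ_delta (a := 0)); [by []|lia|].
  by move=> x x0; rewrite /btw; nia.
case: (Z.lt_trichotomy z 0) => [zn|[//|zp]]; last by rewrite pos; lia.
rewrite -[RHS](pos (- z)); try lia.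
apply: eq_sumZ => x; rewrite !altD altN; congr (_ * _).
by rewrite /btw; nia.
Qed.

(** * Involutions of the quadric *)

Section Vanishing.

Variables (B : nat) (n : Z).
Hypotheses (n0 : 0 < n) (nB : 3 * n <= Z.of_nat B).

Definition form4 (x y z s : Z) : Z := x * y + y * z + z * x + s * s.

Definition tot (phi : Z -> Z -> Z -> Z -> Z) : Z :=
  \sumZ_(t <- box4 B) let: (x, y, z, s) := t in
    if form4 x y z s =? n then parity_sign3 x y z * phi x y z s else 0.

Lemma totD phi psi :
  tot (fun x y z s => phi x y z s + psi x y z s) = tot phi + tot psi.
Proof.
rewrite -sumZD; apply: eq_sumZ => -[[[x y] z] s].
by case: ifP => _; ring.
Qed.

Lemma totM c phi : tot (fun x y z s => c * phi x y z s) = c * tot phi.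
Proof.
rewrite -sumZM; apply: eq_sumZ => -[[[x y] z] s].
by case: ifP => _; ring.
Qed.

Lemma eq_tot phi psi :
  (forall x y z s, form4 x y z s = n -> phi x y z s = psi x y z s) ->
  tot phi = tot psi.
Proof.
move=> E; apply: eq_sumZ => -[[[x y] z] s].
by case: Z.eqb_spec => // /E ->.
Qed.

Lemma parity_sign3_rot x y z : parity_sign3 y z x = parity_sign3 x y z.
Proof.
rewrite /parity_sign3 !Z.even_sub.
by case: (Z.even x); case: (Z.even y); case: (Z.even z).
Qed.

Lemma parity_sign3_swap x y z : parity_sign3 z y x = parity_sign3 x y z.
Proof.
rewrite /parity_sign3 !Z.even_sub.
by case: (Z.even x); case: (Z.even y); case: (Z.even z).
Qed.

Lemma parity_sign3_neg x y z : parity_sign3 (- x) (- y) (- z) = parity_sign3 x y z.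
Proof. by rewrite /parity_sign3 !Z.even_sub !Z.even_opp. Qed.

Lemma tot_rot phi : tot (fun x y z s => phi y z x s) = tot phi.
Proof.
apply: (sum_bij (h := fun t => let: (x, y, z, s) := t in (y, z, x, s))
                (k := fun t => let: (x, y, z, s) := t in (z, x, y, s)));
  rewrite ?box4_uniq // => -[[[x y] z] s] /=; rewrite !mem_box4 => tB _; split=> //; try lia.
all: rewrite ?(parity_sign3_rot x y z) -?(parity_sign3_rot z x y).
all: by congr (if _ then _ else _); rewrite /form4; lia.
Qed.

Lemma tot_swap phi : tot (fun x y z s => phi z y x s) = tot phi.
Proof.
apply: (sum_bij (h := fun t => let: (x, y, z, s) := t in (z, y, x, s))
                (k := fun t => let: (x, y, z, s) := t in (z, y, x, s)));
  rewrite ?box4_uniq // => -[[[x y] z] s] /=; rewrite !mem_box4 => tB _; split=> //; try lia.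
all: rewrite parity_sign3_swap; congr (if _ then _ else _); rewrite /form4; lia.
Qed.

Lemma tot_neg phi : tot (fun x y z s => phi (- x) (- y) (- z) s) = tot phi.
Proof.
clear n0 nB; apply: (sum_bij (h := fun t => let: (x, y, z, s) := t in (- x, - y, - z, s))
                (k := fun t => let: (x, y, z, s) := t in (- x, - y, - z, s)));
  rewrite ?box4_uniq // => -[[[x y] z] s] /=; rewrite !mem_box4 => tB _;
  split; rewrite ?Z.opp_involutive //; try lia.
all: rewrite parity_sign3_neg; congr (if _ then _ else _); rewrite /form4; lia.
Qed.

Lemma tot_negs phi : tot (fun x y z s => phi x y z (- s)) = tot phi.
Proof.
clear n0 nB; apply: (sum_bij (h := fun t => let: (x, y, z, s) := t in (x, y, z, - s))
                (k := fun t => let: (x, y, z, s) := t in (x, y, z, - s)));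
  rewrite ?box4_uniq // => -[[[x y] z] s] /=; rewrite !mem_box4 => tB _;
  split; rewrite ?Z.opp_involutive //; try lia.
all: congr (if _ then _ else _); rewrite /form4; lia.
Qed.

(** The terms [a * d] and [- (b * c)] are positive integers with sum n, so no entry exceeds n.
    Coordinates on the support of a crossing are then at most 3 n, whence the size of the box. *)
Lemma minor_bound a b c d : a * d - b * c = n -> 0 < a * d -> b * c < 0 ->
  [/\ Z.abs a <= n, Z.abs b <= n, Z.abs c <= n & Z.abs d <= n].
Proof.
move=> E ad bc.
have Ead : Z.abs a * Z.abs d = a * d by rewrite -Z.abs_mul; lia.
have Ebc : Z.abs b * Z.abs c = - (b * c) by rewrite -Z.abs_mul; lia.
have [a1 d1] : 1 <= Z.abs a /\ 1 <= Z.abs d by nia.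
have [b1 c1] : 1 <= Z.abs b /\ 1 <= Z.abs c by nia.
by split; nia.
Qed.

(** The bound is applied again at the image point, where [phi] is still nonzero; [h] itself need not
    preserve the box. *)
Lemma tot_antisym (phi : Z -> Z -> Z -> Z -> Z) (h : Z * Z * Z * Z -> Z * Z * Z * Z) :
    (forall x y z s, form4 x y z s = n -> phi x y z s <> 0 ->
      [/\ Z.abs x <= 3 * n, Z.abs y <= 3 * n, Z.abs z <= 3 * n & Z.abs s <= 3 * n]) ->
    (forall x y z s, let: (x', y', z', s') := h (x, y, z, s) in
      [/\ h (x', y', z', s') = (x, y, z, s), form4 x' y' z' s' = form4 x y z s,
          parity_sign3 x' y' z' = parity_sign3 x y z &
          phi x' y' z' s' = - phi x y z s]) ->
  tot phi = 0.
Proof.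
move=> bnd hP; apply: (sum_antisym (h := h)); rewrite ?box4_uniq //.
move=> [[[x y] z] s] _ /=; case: Z.eqb_spec => // E nz.
have := hP x y z s; case: (h _) => [[[x' y'] z'] s'] [-> E' -> phi'].
have nz' : phi x' y' z' s' <> 0.
  by move=> p0; apply: nz; have -> : phi x y z s = 0; [lia | rewrite Z.mul_0_r].
have [? ? ? ?] := bnd _ _ _ _ (etrans E' E) nz'.
split=> //; first by rewrite mem_box4; apply/and4P; split; lia.
by rewrite E' E Z.eqb_refl phi' Z.mul_opp_r.
Qed.

(* The involution keeps the entries s - x and s - z of the minor
   (s - x) (s - z) + (x + z) (s + y) = n and negates x + z and s + y. *)
Lemma tot_crossX : tot crossX = 0.
Proof.
apply: (@tot_antisym _ (fun t => let: (x, y, z, s) := t in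
  (- z, x + z - 2 * s - y, - x, s - x - z))) => x y z s.
  rewrite /crossX /cross => E; case: ifP => // /andP[/Z.ltb_lt A /Z.ltb_lt C] _.
  have E' : (s - x) * (s - z) - (x + z) * - (s + y) = n by rewrite -E /form4; ring.
  rewrite -Z.sgn_mul in A; rewrite -Z.sgn_mul in C.
  have [? ? ? ?] := minor_bound E' ltac:(lia) ltac:(lia).
  by clear E A C E'; split; lia.
split.
- by congr (_, _, _, _); lia.
- by rewrite /form4; ring.
- rewrite /parity_sign3 !(Z.even_sub, Z.even_add, Z.even_opp, Z.even_mul) /=.
  by case: (Z.even x); case: (Z.even y); case: (Z.even z).
rewrite /crossX.
have -> : s - x - z - - z = s - x by lia.
have -> : - z + - x = - (x + z) by lia.
have -> : - (s - x - z + (x + z - 2 * s - y)) = s + y by lia.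
have -> : s - x - z - - x = s - z by lia.
rewrite /cross !Z.sgn_opp !Z.mul_opp_l !Z.mul_opp_r.
by case: ifP => _; rewrite ?Z.opp_involutive.
Qed.

(* Here x + z and y + z are kept, s + z and s - z are exchanged. *)
Lemma tot_crossY : tot crossY = 0.
Proof.
apply: (@tot_antisym _ (fun t => let: (x, y, z, s) := t in
  (x + 2 * z, y + 2 * z, - z, s))) => x y z s.
  rewrite /crossY => E; case: ifP => // /andP[/Z.ltb_lt A /Z.ltb_lt C] _.
  have E' : (x + z) * (y + z) - (s - z) * - (s + z) = n by rewrite -E /form4; ring.
  rewrite -Z.sgn_mul in A; rewrite -Z.sgn_mul in C.
  have [? ? ? ?] := minor_bound E' ltac:(lia) ltac:(lia).
  by clear E A C E'; split; lia.
split.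
- by congr (_, _, _, _); lia.
- by rewrite /form4; ring.
- rewrite /parity_sign3 !(Z.even_sub, Z.even_add, Z.even_opp, Z.even_mul) /=.
  by case: (Z.even x); case: (Z.even y); case: (Z.even z).
rewrite /crossY.
have -> : s + - z = s - z by lia.
have -> : s - - z = s + z by lia.
have -> : x + 2 * z + - z = x + z by lia.
have -> : y + 2 * z + - z = y + z by lia.
rewrite Z.sgn_opp Z.mul_opp_l (Z.mul_comm (Z.sgn (s - z))).
by case: ifP.
Qed.

End Vanishing.

Lemma onE a w : on a w = if a =? 0 then w else 0.
Proof. by rewrite /on; case: Z.eqb_spec => ?; case: Z.eqb_spec => ? //; lia. Qed.

(** * Terms on hyperplanes as divisor sums *)

Section Evaluation.

Variables (B : nat) (n : Z).
Hypotheses (n0 : 0 < n) (nB : 3 * n <= Z.of_nat B).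

Local Notation tot := (tot B n).

Lemma factor_bounds d e : d * e = n -> Z.abs d <= n /\ Z.abs e <= n.
Proof.
move=> E; have Ea : Z.abs d * Z.abs e = n by rewrite -Z.abs_mul; lia.
by have [? ?] : 1 <= Z.abs d /\ 1 <= Z.abs e; [nia | split; nia].
Qed.

Lemma parity_sign2_neg d e : parity_sign2 (- d) (- e) = parity_sign2 d e.
Proof. by rewrite /parity_sign2 !Z.even_opp. Qed.

Definition facsum (g : Z -> Z -> Z) : Z :=
  \sumZ_(t <- box2 B) let: (d, e) := t in
    if d * e =? n then parity_sign2 d e * g d e else 0.

(** Since n > 0, both factors have the same sign, and the negative pairs repeat the positive
    ones. *)
Lemma facsum_abs : facsum (fun _ e => Z.abs e) = 2 * divsum B n.
Proof.
have -> : facsum (fun _ e => Z.abs e) = divsum B n +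
    \sumZ_(t <- box2 B) let: (d, e) := t in
      if [&& d <? 0, e <? 0 & d * e =? n] then parity_sign2 d e * - e else 0.
  rewrite -sumZD; apply: eq_sumZ => -[d e] /=.
  case: (Z.eqb_spec (d * e)) => E; last by rewrite !andbF.
  case: (Z.ltb_spec 0 d) => d0.
    have e0 : 0 < e by clear -E d0 n0; nia.
    rewrite (_ : (0 <? e) = true); last by clear E; lia.
    rewrite (_ : (d <? 0) = false) /=; last by clear E; lia.
    by rewrite Z.abs_eq; [ring | exact: Z.lt_le_incl].
  have dn : d <> 0 by move=> d1; move: E; rewrite d1; lia.
  have d1 : d < 0 by clear -d0 dn; lia.
  have e1 : e < 0 by clear -E d1 n0; nia.
  rewrite (_ : (d <? 0) = true); last by clear E; lia.
  rewrite (_ : (e <? 0) = true) /=; last by clear E; lia.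
  by rewrite Z.abs_neq; [ring | exact: Z.lt_le_incl].
suff -> : \sumZ_(t <- box2 B) (let: (d, e) := t in
    if [&& d <? 0, e <? 0 & d * e =? n] then parity_sign2 d e * - e else 0) =
  divsum B n by lia.
apply: (sum_bij (h := fun t => let: (d, e) := t in (- d, - e))
                (k := fun t => let: (d, e) := t in (- d, - e)));
  rewrite ?box2_uniq // => -[d e] /=; rewrite !mem_pairs !mem_rg => tB _;
  split; rewrite ?Z.opp_involutive ?parity_sign2_neg //; try lia.
all: by congr (if _ then _ else _); lia.
Qed.

(** As d and e have the same sign, the absolute value is additive, and exchanging them equates the
    two parts. *)
Lemma facsum_abs_add : facsum (fun d e => Z.abs (d + e)) = 4 * divsum B n.
Proof.
have E2 : facsum (fun d _ => Z.abs d) = facsum (fun _ e => Z.abs e).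
  apply: (sum_involution (h := fun t => let: (d, e) := t in (e, d)));
    rewrite ?box2_uniq // => -[d e] /=; rewrite !mem_pairs !mem_rg => tB _; split=> //; try lia;
    by rewrite (Z.mul_comm e d) /parity_sign2 (andbC (Z.even e)).
have -> : facsum (fun d e => Z.abs (d + e)) =
    facsum (fun d _ => Z.abs d) + facsum (fun _ e => Z.abs e).
  rewrite -sumZD; apply: eq_sumZ => -[d e].
  case: Z.eqb_spec => // E; rewrite -Z.mul_add_distr_l; congr (_ * _).
  by clear -E n0; nia.
by rewrite E2 facsum_abs; lia.
Qed.

(** On s = x the form factors as (x + y) (x + z). With d = x + y and e = x + z fixed, x stays free
    and [sum_btw] gives |e|. *)
Lemma tot_edge : tot (fun x y z s => on (s - x) (btw x (z - x))) = 2 * divsum B n.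
Proof.
rewrite -facsum_abs.
transitivity (\sumZ_(t <- box3 B) let: (d, e, x) := t in
    if d * e =? n then parity_sign2 d e * btw x (e - x - x) else 0).
  apply: (sum_bij (h := fun t => let: (x, y, z, s) := t in (x + y, x + z, x))
                  (k := fun t => let: (d, e, x) := t in (x, d - x, e - x, x)));
    rewrite ?box3_uniq ?box4_uniq //.
  - move=> [[[x y] z] s] /=; rewrite mem_box4 mem_box3 => tB.
    case: Z.eqb_spec => // E; rewrite onE; case: Z.eqb_spec => [sx _|]; last by rewrite Z.mul_0_r.
    have -> : s = x by lia.
    have E' : (x + y) * (x + z) = n by rewrite -E /form4 (_ : s = x); [ring | lia].
    have [? ?] := factor_bounds E'.
    split; [by clear E E'; lia | by congr (_, _, _, _); lia |].
    rewrite E' Z.eqb_refl; congr (_ * _); last by congr btw; lia.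
    rewrite /parity_sign2 /parity_sign3 !(Z.even_sub, Z.even_add).
    by case: (Z.even x); case: (Z.even y); case: (Z.even z).
  move=> [[d e] x] /=; rewrite mem_box4 mem_box3 => tB.
  case: Z.eqb_spec => // E nz; have [? ?] := factor_bounds E.
  have xe : Z.abs x <= Z.abs e.
    have : btw x (e - x - x) <> 0 by move=> b0; apply: nz; rewrite b0 Z.mul_0_r.
    by clear -E n0; rewrite /btw; nia.
  split; [by clear E nz; lia | by congr (_, _, _); lia |].
  have -> : form4 x (d - x) (e - x) x = n by rewrite /form4 -E; ring.
  rewrite Z.eqb_refl onE Z.sub_diag /=; congr (_ * _).
  rewrite /parity_sign2 /parity_sign3 !(Z.even_sub, Z.even_add).
  by case: (Z.even x); case: (Z.even d); case: (Z.even e).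
rewrite sum_box3 /facsum sum_box2; apply: eq_sumZ => d; apply: eq_sumZ => e.
case: Z.eqb_spec => E; last exact: sumZ0.
have [? ?] := factor_bounds E.
by rewrite sumZM sum_btw //; nia.
Qed.

(** On s = y the form is d e with d = x + y and e = y + z, and the sum over y gives |d + e|. *)
Lemma tot_middle : tot (fun x y z s => on (s - y) (btw y (x + z))) = 4 * divsum B n.
Proof.
rewrite -facsum_abs_add.
transitivity (\sumZ_(t <- box3 B) let: (d, e, y) := t in
    if d * e =? n then parity_sign2 d e * btw y (d + e - y - y) else 0).
  apply: (sum_bij (h := fun t => let: (x, y, z, s) := t in (x + y, y + z, y))
                  (k := fun t => let: (d, e, y) := t in (d - y, y, e - y, y)));
    rewrite ?box3_uniq ?box4_uniq //.
  - move=> [[[x y] z] s] /=; rewrite mem_box4 mem_box3 => tB.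
    case: Z.eqb_spec => // E; rewrite onE; case: Z.eqb_spec => [sy _|]; last by rewrite Z.mul_0_r.
    have -> : s = y by lia.
    have E' : (x + y) * (y + z) = n by rewrite -E /form4 (_ : s = y); [ring | lia].
    have [? ?] := factor_bounds E'.
    split; [by clear E E'; lia | by congr (_, _, _, _); lia |].
    rewrite E' Z.eqb_refl; congr (_ * _); last by congr btw; lia.
    rewrite /parity_sign2 /parity_sign3 !(Z.even_sub, Z.even_add).
    by case: (Z.even x); case: (Z.even y); case: (Z.even z).
  move=> [[d e] y] /=; rewrite mem_box4 mem_box3 => tB.
  case: Z.eqb_spec => // E nz; have [? ?] := factor_bounds E.
  have ye : 2 * Z.abs y <= Z.abs (d + e).
    have : btw y (d + e - y - y) <> 0 by move=> b0; apply: nz; rewrite b0 Z.mul_0_r.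
    have : d + e <> 0 by nia.
    by clear; rewrite /btw; nia.
  split; [by clear E nz; lia | by congr (_, _, _); lia |].
  have -> : form4 (d - y) y (e - y) y = n by rewrite /form4 -E; ring.
  rewrite Z.eqb_refl onE Z.sub_diag /=; congr (_ * _); last by congr btw; lia.
  rewrite /parity_sign2 /parity_sign3 !(Z.even_sub, Z.even_add).
  by case: (Z.even y); case: (Z.even d); case: (Z.even e).
rewrite sum_box3 /facsum sum_box2; apply: eq_sumZ => d; apply: eq_sumZ => e.
case: Z.eqb_spec => E; last exact: sumZ0.
have [? ?] := factor_bounds E.
by rewrite sumZM sum_btw //; nia.
Qed.

Lemma diff_bounds s z : s * s - z * z = n ->
  [/\ s <> 0, Z.abs s <= n & Z.abs z <= n].
Proof.
move=> E; have E' : (s - z) * (s + z) = n by lia.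
by have [? ?] := factor_bounds E'; split; [nia | lia | lia].
Qed.

Lemma parity_sign3_opp x z : parity_sign3 x (- z) z = - alt (x + z).
Proof.
rewrite /parity_sign3 /alt !(Z.even_sub, Z.even_add, Z.even_opp).
by case: (Z.even x); case: (Z.even z).
Qed.

Lemma sum_sqrts_diff : \sumZ_(z <- rg B) \sumZ_(s <- rg B)
    (if (s * s - z * z =? n) && (z =? 0) then 1 else 0) = sqrts B n.
Proof.
rewrite (sumZ_delta (a := 0)); last 2 first.
- lia.
- by move=> z z0; apply: sumZ0 => s _; rewrite ifF //; lia.
by apply: eq_sumZ => s; rewrite andbT Z.sub_0_r.
Qed.

(** On y = - z the form is s^2 - z^2, free of x, and the alternating sum over x vanishes unless z =
    0. *)
Lemma tot_diagonal : tot (fun x y z s => on (y + z) (btw (z - x) (z + x))) = - sqrts B n.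
Proof.
transitivity (\sumZ_(t <- box3 B) let: (z, s, x) := t in
    if s * s - z * z =? n then - (alt (x + z) * btw (z - x) (z + x)) else 0).
  apply: (sum_bij (h := fun t => let: (x, y, z, s) := t in (z, s, x))
                  (k := fun t => let: (z, s, x) := t in (x, - z, z, s)));
    rewrite ?box3_uniq ?box4_uniq //.
  - move=> [[[x y] z] s] /=; rewrite mem_box4 mem_box3 => tB.
    case: Z.eqb_spec => // E; rewrite onE; case: Z.eqb_spec => [yz _|]; last by rewrite Z.mul_0_r.
    have -> : y = - z by lia.
    split=> //; first lia.
    rewrite ifT; last by rewrite -E /form4 (_ : y = - z); [apply/Z.eqb_spec; ring | lia].
    by rewrite parity_sign3_opp Z.mul_opp_l.
  move=> [[z s] x] /=; rewrite mem_box4 mem_box3 => tB.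
  case: Z.eqb_spec => // E _; split=> //; first lia.
  rewrite ifT; last by rewrite -E /form4; apply/Z.eqb_spec; ring.
  rewrite onE (_ : - z + z = 0); last lia.
  by rewrite parity_sign3_opp Z.mul_opp_l.
rewrite sum_box3 -sum_sqrts_diff -sumZN; apply: eq_sumZ => z.
rewrite -sumZN; apply: eq_sumZ => s.
case: Z.eqb_spec => E; last exact: sumZ0.
have [_ ? ?] := diff_bounds E.
by rewrite sumZN sum_alt_btw //; lia.
Qed.

(** On z = - x the form is s^2 - x^2, free of y. As n > 0 forces s to be nonzero, every alternating
    sum over y vanishes. *)
Lemma tot_diagonal_trace :
  tot (fun x y z s => on (x + z) (btw (s - y) (s + y))) = 0.
Proof.
transitivity (\sumZ_(t <- box3 B) let: (x, s, y) := t in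
    if s * s - x * x =? n then - (alt (y + x) * btw (s - y) (s + y)) else 0).
  apply: (sum_bij (h := fun t => let: (x, y, z, s) := t in (x, s, y))
                  (k := fun t => let: (x, s, y) := t in (x, y, - x, s)));
    rewrite ?box3_uniq ?box4_uniq //.
  - move=> [[[x y] z] s] /=; rewrite mem_box4 mem_box3 => tB.
    case: Z.eqb_spec => // E; rewrite onE; case: Z.eqb_spec => [yz _|]; last by rewrite Z.mul_0_r.
    have -> : z = - x by lia.
    split=> //; first lia.
    rewrite ifT; last by rewrite -E /form4 (_ : z = - x); [apply/Z.eqb_spec; ring | lia].
    by rewrite -parity_sign3_rot parity_sign3_opp Z.mul_opp_l.
  move=> [[x s] y] /=; rewrite mem_box4 mem_box3 => tB.
  case: Z.eqb_spec => // E _; split=> //; first lia.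
  rewrite ifT; last by rewrite -E /form4; apply/Z.eqb_spec; ring.
  rewrite onE (_ : x + - x = 0); last lia.
  by rewrite -parity_sign3_rot parity_sign3_opp Z.mul_opp_l.
rewrite sum_box3; apply: sumZ0 => x _; apply: sumZ0 => s _.
case: Z.eqb_spec => E; last exact: sumZ0.
have [s0 ? ?] := diff_bounds E.
have -> : \sumZ_(y <- rg B) - (alt (y + x) * btw (s - y) (s + y)) =
    - alt (x - s) * \sumZ_(y <- rg B) alt (y + s) * btw (s - y) (s + y).
  rewrite -sumZM; apply: eq_sumZ => y.
  have -> : y + x = (x - s) + (y + s) by lia.
  by rewrite altD; ring.
rewrite sum_alt_btw; last lia.
by case: Z.eqb_spec => //; lia.
Qed.

(** At x = y = z = 0 [parity_sign3] is -1 and the form is s^2. *)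
Lemma tot_origin : tot (fun x y z _ => origin x y z) = - sqrts B n.
Proof.
rewrite /tot sum_box4 (sumZ_delta (a := 0)); [|lia|]; last first.
  move=> x x0; do 3 apply: sumZ0 => ? _.
  rewrite /origin !onE (_ : (x =? 0) = false); last lia.
  by rewrite Z.mul_0_r; case: ifP.
rewrite (sumZ_delta (a := 0)); [|lia|]; last first.
  move=> x x0; do 2 apply: sumZ0 => ? _.
  rewrite /origin !onE (_ : (x =? 0) = false); last lia.
  by rewrite Z.mul_0_r; case: ifP.
rewrite (sumZ_delta (a := 0)); [|lia|]; last first.
  move=> x x0; apply: sumZ0 => ? _.
  rewrite /origin !onE (_ : (x =? 0) = false); last lia.
  by rewrite Z.mul_0_r; case: ifP.
rewrite /sqrts -sumZN; apply: eq_sumZ => s.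
by rewrite /form4 !Z.mul_0_l !Z.add_0_l; case: ifP.
Qed.

(** Summed over the quadric, [crossing_identity] loses its crossings. With D = [divsum B n], the
    four edges give 2 D each, the two middle terms 4 D each and the three diagonals [- sqrts] each;
    negation makes the two [wt] terms equal. *)
Lemma class_sum : tot (fun x y z _ => wt x y z) + sqrts B n = 8 * divsum B n.
Proof.
have E : tot (fun x y z _ => wt x y z + wt (- x) (- y) (- z) + origin x y z) =
  tot (fun x y z s =>
  2 * crossX x y z s + 2 * crossX x y z (- s)
  + 2 * crossY x y z s + 2 * crossY y z x s + 2 * crossY z x y s
  + on (s - x) (btw x (z - x)) + on (s + x) (btw x (z - x))
  + on (s - z) (btw z (x - z)) + on (s + z) (btw z (x - z))
  + on (s - y) (btw y (x + z)) + on (s + y) (btw y (x + z))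
  + on (y + z) (btw (z - x) (z + x)) + on (x + y) (btw (y - z) (y + z))
  + on (x + z) (btw (x - y) (x + y) - btw (s - y) (s + y))).
  by apply: eq_tot => x y z s E; apply: crossing_identity; rewrite -/(form4 x y z s) E.
move: E; rewrite !totD !totM tot_crossX //.
rewrite (tot_neg B n (fun x y z _ => wt x y z)) (tot_negs B n crossX) tot_crossX //.
rewrite (tot_rot B n crossY).
rewrite (_ : tot (fun x y z s => crossY z x y s) = tot crossY); last first.
  by rewrite -(tot_rot B n (fun x y z s => crossY z x y s)).
rewrite tot_crossY // tot_edge tot_middle tot_diagonal tot_origin.
have -> : tot (fun x y z s => on (s + x) (btw x (z - x))) = 2 * divsum B n.
  rewrite -tot_edge -(tot_negs B n (fun x y z s => on (s + x) (btw x (z - x)))).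
  by apply: eq_tot => x y z s _; rewrite !onE; congr (if _ then _ else _); lia.
have -> : tot (fun x y z s => on (s - z) (btw z (x - z))) = 2 * divsum B n.
  by rewrite -tot_edge -[RHS]tot_swap.
have -> : tot (fun x y z s => on (s + z) (btw z (x - z))) = 2 * divsum B n.
  rewrite -tot_edge -[RHS]tot_swap.
  rewrite -(tot_negs B n (fun x y z s => on (s + z) (btw z (x - z)))).
  by apply: eq_tot => x y z s _; rewrite !onE; congr (if _ then _ else _); lia.
have -> : tot (fun x y z s => on (s + y) (btw y (x + z))) = 4 * divsum B n.
  rewrite -tot_middle -(tot_negs B n (fun x y z s => on (s + y) (btw y (x + z)))).
  by apply: eq_tot => x y z s _; rewrite !onE; congr (if _ then _ else _); lia.
have D2 : tot (fun x y z s => on (x + y) (btw (y - z) (y + z))) = - sqrts B n.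
  rewrite -tot_diagonal -[RHS]tot_swap.
  apply: eq_tot => x y z s _; rewrite !onE Z.add_comm.
  by case: Z.eqb_spec => // ?; rewrite /btw; nia.
rewrite D2.
have -> : tot (fun x y z s => on (x + z) (btw (x - y) (x + y) - btw (s - y) (s + y))) =
    tot (fun x y z s => on (x + z) (btw (x - y) (x + y))) +
    (-1) * tot (fun x y z s => on (x + z) (btw (s - y) (s + y))).
  rewrite -totM -totD; apply: eq_tot => x y z s _.
  by rewrite !onE; case: ifP => _; lia.
have D3 : tot (fun x y z s => on (x + z) (btw (x - y) (x + y))) = - sqrts B n.
  rewrite -D2 -(tot_rot B n (fun x y z s => on (x + z) (btw (x - y) (x + y)))).
  by apply: eq_tot => x y z s _; rewrite Z.add_comm.
rewrite D3 tot_diagonal_trace.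
by lia.
Qed.

End Evaluation.

End ClassSum.

(** * The three-square theorem *)

Section ThreeSquares.

Local Open Scope Z_scope.

Definition form3 (x y z : Z) : Z := x * y + y * z + z * x.

(** The summand [origin] matters only for m = 0, where it counts the one representation of 0. *)
Definition class3 (B : nat) (m : Z) : Z :=
  \sumZ_(t <- box3 B) let: (x, y, z) := t in
    if form3 x y z =? m then parity_sign3 x y z * wt x y z + origin x y z else 0.

Lemma wt_ge0 x y z : 0 <= wt x y z.
Proof.
rewrite /wt; have := sgn_casesP x; have := sgn_casesP y; have := sgn_casesP z.
by case=> [[-> _]|[[-> _]|[-> _]]]; case=> [[-> _]|[[-> _]|[-> _]]];
  case=> [[-> _]|[[-> _]|[-> _]]].
Qed.

Lemma wt_neq0 x y z : wt x y z <> 0 ->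
  [/\ 0 <= x, 0 <= y, 0 <= z & 0 < form3 x y z].
Proof.
rewrite /wt /form3; have := sgn_casesP x; have := sgn_casesP y; have := sgn_casesP z.
case=> [[-> ?]|[[-> ?]|[-> ?]]]; case=> [[-> ?]|[[-> ?]|[-> ?]]];
  case=> [[-> ?]|[[-> ?]|[-> ?]]] // _; split; nia.
Qed.

Lemma class3_conv B n : 0 < n -> 3 * n <= Z.of_nat B ->
  \sumZ_(s <- rg B) class3 B (n - s * s) = jacobi4 B n.
Proof.
move=> n0 nB.
(* The factor -1 offsets the parity sign -1 at the origin. *)
have -> : jacobi4 B n = tot B n (fun x y z _ => wt x y z + (-1) * origin x y z).
  rewrite totD totM tot_origin // /jacobi4 -class_sum //.
  by case: Z.eqb_spec => ?; lia.
rewrite /tot /box4 big_allpairs [RHS]exchange_big.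
apply: eq_sumZ => s; apply: eq_sumZ => -[[x y] z].
have -> : (form3 x y z =? n - s * s) = (form4 x y z s =? n).
  by rewrite /form3 /form4; lia.
case: ifP => // _; rewrite Z.mul_add_distr_l.
suff -> : parity_sign3 x y z * (-1 * origin x y z) = origin x y z by [].
rewrite /origin !onE.
case: (Z.eqb_spec x 0) => [->|_]; last by lia.
case: (Z.eqb_spec y 0) => [->|_]; last by lia.
by case: (Z.eqb_spec z 0) => [->|_]; last by lia.
Qed.

Lemma class3_neg B m : m < 0 -> class3 B m = 0.
Proof.
move=> m0; apply: sumZ0 => -[[x y] z] _.
case: Z.eqb_spec => // E.
have -> : wt x y z = 0.
  by case: (Z.eq_dec (wt x y z) 0) => // /wt_neq0 [_ _ _ ?]; lia.
rewrite Z.mul_0_r /origin !onE.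
by case: Z.eqb_spec => // x0; case: Z.eqb_spec => // y0; case: Z.eqb_spec => // z0;
  move: E; rewrite x0 y0 z0 /form3; lia.
Qed.

Lemma class3_0 B : class3 B 0 = 1.
Proof.
have wt0 x y z : form3 x y z = 0 -> wt x y z = 0.
  by move=> E; case: (Z.eq_dec (wt x y z) 0) => // /wt_neq0 [_ _ _ ?]; lia.
rewrite /class3 sum_box3 (sumZ_delta (a := 0)); [|lia|]; last first.
  move=> x x0; do 2 apply: sumZ0 => ? _; case: Z.eqb_spec => // /wt0 ->.
  by rewrite /origin onE ifF; lia.
rewrite (sumZ_delta (a := 0)); [|lia|]; last first.
  move=> x x0; apply: sumZ0 => ? _; case: Z.eqb_spec => // /wt0 ->.
  by rewrite /origin !onE (_ : (x =? 0) = false) ?Z.mul_0_r //; lia.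
rewrite (sumZ_delta (a := 0)) //; first by lia.
move=> x x0; case: Z.eqb_spec => // /wt0 ->.
by rewrite /origin !onE (_ : (x =? 0) = false) ?Z.mul_0_r //; lia.
Qed.

(** Both functions have r_4 as convolution with the squares; the term s = 0 is the value at n, and
    the others agree by induction. *)
Theorem three_squares_count B m : 3 * m <= Z.of_nat B -> sqcount B 3 m = class3 B m.
Proof.
elim/Z_lt_wf_ind: m => n IH nB.
have [n0|[->|n0]] := Z.lt_trichotomy n 0.
- by rewrite sqcount_neg // class3_neg.
- by rewrite sqcount_0 class3_0.
have : \sumZ_(s <- rg B) (sqcount B 3 (n - s * s) + - class3 B (n - s * s)) = 0.
  rewrite sumZD sumZN class3_conv // -four_squares_count; last lia.
  by rewrite Z.add_opp_diag_r.
rewrite (sumZ_delta (a := 0)); [|lia|by move=> s s0; rewrite IH; nia].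
have -> : n - 0 * 0 = n by lia.
by lia.
Qed.

Lemma sumZ_le (T : eqType) (S : seq T) (F G : T -> Z) :
  (forall t, t \in S -> F t <= G t) -> \sumZ_(t <- S) F t <= \sumZ_(t <- S) G t.
Proof.
move=> FG.
suff : 0 <= \sumZ_(t <- S) (G t + - F t) by rewrite sumZD sumZN; lia.
by apply: sumZ_ge0 => t /FG; lia.
Qed.

Lemma sumZ_inj_le (T U : eqType) (S : seq T) (R : seq U) (F : T -> Z) (G : U -> Z)
    (h : T -> U) (k : U -> T) :
    uniq S -> uniq R -> (forall u, 0 <= G u) ->
    (forall t, t \in S -> F t <> 0 -> [/\ h t \in R, k (h t) = t & F t <= G (h t)]) ->
  \sumZ_(t <- S) F t <= \sumZ_(u <- R) G u.
Proof.
move=> uS uR G0 hS.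
(* The function F transported along [h] and extended by 0. *)
pose G' u := if (k u \in S) && (h (k u) == u) then F (k u) else 0.
have -> : \sumZ_(t <- S) F t = \sumZ_(u <- R) G' u.
  apply: (sum_bij (h := h) (k := k)) => // t tS.
    by move=> Ft; have [? E _] := hS t tS Ft; split=> //; rewrite /G' E tS eqxx.
  by rewrite /G'; case: ifP => // /andP[kS /eqP ->].
apply: sumZ_le => u _; rewrite /G'; case: ifP => // /andP[kS /eqP E].
by case: (Z.eq_dec (F (k u)) 0) => [->//|Fk]; have [_ _] := hS _ kS Fk; rewrite E.
Qed.

Lemma sumZ_ge_term (T : eqType) (S : seq T) (F : T -> Z) (a : T) :
  uniq S -> a \in S -> (forall t, 0 <= F t) -> F a <= \sumZ_(t <- S) F t.
Proof.
move=> uS aS F0; have -> : F a = \sumZ_(t <- [:: a]) F t by rewrite big_seq1.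
apply: (sumZ_inj_le (h := id) (k := id)) => // t; rewrite inE => /eqP -> _; split=> //.
exact: Z.le_refl.
Qed.

Lemma Zeven_ex a : Z.even a -> exists c, a = 2 * c.
Proof. by move/Z.even_spec => [c ->]; exists c. Qed.

(** If x, y, z have the same parity, the form is 3 z^2 modulo 4, hence 0 or 3. So no negative sign
    occurs here, and (0, 1, m) contributes a positive term. *)
Lemma class3_pos12 B m : 0 < m -> 3 * m <= Z.of_nat B ->
  m mod 4 = 1 \/ m mod 4 = 2 -> 0 < class3 B m.
Proof.
move=> m0 mB m4.
pose F (t : Z * Z * Z) := let: (x, y, z) := t in
    if form3 x y z =? m then parity_sign3 x y z * wt x y z + origin x y z else 0.
have F0 t : 0 <= F t.
  case: t => [[x y] z]; rewrite /F; case: Z.eqb_spec => // E.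
  have o0 : 0 <= origin x y z by rewrite /origin !onE; do 3 case: ifP => _ //.
  have w0 : 0 <= wt x y z by exact: wt_ge0.
  suff -> : parity_sign3 x y z = 1 by lia.
  rewrite /parity_sign3; case: ifP => // /andP[/Zeven_ex[i xy] /Zeven_ex[j yz]].
  have Q : m = 3 * (z * z) + 4 * (2 * j * z + i * z + j * j + i * j).
    have yE : y = z + 2 * j by clear -yz; lia.
    have xE : x = z + 2 * j + 2 * i by clear -xy yE; lia.
    by rewrite -E xE yE /form3; ring.
  have [k [zk|zk]] : exists k, z = 2 * k \/ z = 2 * k + 1.
    by case: (Z.Even_or_Odd z) => -[k ->]; exists k; [left|right].
  - have {}Q : m = 4 * (3 * (k * k) + (2 * j * z + i * z + j * j + i * j)) by rewrite Q zk; ring.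
    by move: m4; rewrite Q Z.mul_comm Z.mod_mul //; lia.
  - have {}Q : m = 3 + (3 * (k * k) + 3 * k + (2 * j * z + i * z + j * j + i * j)) * 4.
      by rewrite Q zk; ring.
    by move: m4; rewrite Q Z.mod_add // => -[].
apply: Z.lt_le_trans (@sumZ_ge_term _ (box3 B) F (0, 1, m) _ _ F0).
- by rewrite /F /form3 (_ : _ =? m = true); [case: m m0 mB m4 F F0 | lia].
- exact: box3_uniq.
- by rewrite mem_box3; lia.
Qed.

Definition parity_class (B : nat) (m : Z) (a c d : bool) : Z :=
  \sumZ_(t <- box3 B) let: (x, y, z) := t in
    if [&& form3 x y z =? m, Z.odd x == a, Z.odd y == c & Z.odd z == d]
    then wt x y z else 0.

(** An odd value of the form requires at least two odd variables. *)
Lemma class3_odd B m : Z.odd m -> class3 B m =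
  parity_class B m false true true + parity_class B m true false true
  + parity_class B m true true false + - parity_class B m true true true.
Proof.
move=> om; rewrite -sumZN -!sumZD; apply: eq_sumZ => -[[x y] z].
case: Z.eqb_spec => //= E.
have -> : origin x y z = 0.
  rewrite /origin !onE; case: Z.eqb_spec => // x0; case: Z.eqb_spec => // y0.
  by move: om; rewrite -E /form3 x0 y0 !Z.mul_0_l Z.mul_0_r.
move: om; rewrite -E /form3 /parity_sign3 !Z.odd_add !Z.odd_mul !Z.even_sub -!Z.negb_odd.
by case: (Z.odd x); case: (Z.odd y); case: (Z.odd z) => //= _; lia.
Qed.

Lemma parity_class_swap B m : parity_class B m true true false = parity_class B m true false true.
Proof.
apply: (sum_involution (h := fun t => let: (x, y, z) := t in (x, z, y)));
  rewrite ?box3_uniq // => -[[x y] z] /=; rewrite !mem_box3 => tB _; split=> //; try lia.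
all: have -> : form3 x z y = form3 x y z by rewrite /form3; ring.
all: have -> : wt x z y = wt x y z by rewrite /wt; case: (Z.sgn x) => [|[]|] //;
   case: (Z.sgn y) => [|[]|] //; case: (Z.sgn z) => [|[]|].
all: by case: (_ =? m); case: (Z.odd x); case: (Z.odd y); case: (Z.odd z).
Qed.

(* An all-odd solution (x, y, z) with y >= z yields the solution
   (2 x + z, (y - z) / 2, z), whose middle entry is even. *)
Lemma parity_class_odd_le B m : m mod 8 = 3 -> 0 < m -> 3 * m <= Z.of_nat B ->
  parity_class B m true true true <= 2 * parity_class B m true false true.
Proof.
move=> m8 m0 mB.
pose C x y z := [&& form3 x y z =? m, Z.odd x, Z.odd y & Z.odd z].
have -> : parity_class B m true true true =
    \sumZ_(t <- box3 B) let: (x, y, z) := t in if C x y z then wt x y z else 0.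
  by apply: eq_sumZ => -[[x y] z]; rewrite /C !eqb_id.
(* Adding this zero sum removes the solutions with y < z and doubles those with y > z. *)
have anti : \sumZ_(t <- box3 B) (let: (x, y, z) := t in
    if C x y z then wt x y z * Z.sgn (y - z) else 0) = 0.
  apply: (sum_antisym (h := fun t => let: (x, y, z) := t in (x, z, y)));
    rewrite ?box3_uniq // => -[[x y] z] /=; rewrite !mem_box3 => tB _; split=> //; try lia.
  have -> : wt x z y = wt x y z by rewrite /wt; case: (Z.sgn x) => [|[]|] //;
     case: (Z.sgn y) => [|[]|] //; case: (Z.sgn z) => [|[]|].
  have -> : C x z y = C x y z.
    rewrite /C (_ : form3 x z y = form3 x y z); last by rewrite /form3; ring.
    by case: (Z.odd x); case: (Z.odd y); case: (Z.odd z).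
  by case: ifP => _ //; rewrite -Z.mul_opp_r -Z.sgn_opp; congr (_ * Z.sgn _); lia.
have -> : \sumZ_(t <- box3 B) (let: (x, y, z) := t in if C x y z then wt x y z else 0) =
    \sumZ_(t <- box3 B) let: (x, y, z) := t in
      if C x y z then wt x y z * (1 + Z.sgn (y - z)) else 0.
  rewrite -[LHS]Z.add_0_r -[X in _ + X]anti -sumZD; apply: eq_sumZ => -[[x y] z].
  by case: ifP => _; ring.
rewrite -sumZM.
apply: (sumZ_inj_le
  (h := fun t => let: (x, y, z) := t in (2 * x + z, (y - z) / 2, z))
  (k := fun t => let: (x, y, z) := t in ((x - z) / 2, 2 * y + z, z)));
  rewrite ?box3_uniq //.
  by move=> [[x y] z]; case: ifP => _ //; have : 0 <= wt x y z by [exact: wt_ge0]; lia.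
move=> [[x y] z] _; case: ifP => // /and4P[/Z.eqb_spec E ox oy oz] nz.
have wnz : wt x y z <> 0 by move=> w0; apply: nz; rewrite w0 Z.mul_0_l.
have [x0 y0 z0 _] := wt_neq0 wnz.
have {}x0 : 0 < x by case: (x) x0 ox.
have {}y0 : 0 < y by case: (y) y0 oy.
have {}z0 : 0 < z by case: (z) z0 oz.
have yz : z <= y by move: nz; have -> : wt x y z = 4 by [rewrite /wt !Z.sgn_pos]; lia.
have [a xa] : exists a, x = 2 * a + 1 by move/Z.odd_spec: ox => [a ->]; exists a.
have [c yc] : exists c, y = 2 * c + 1 by move/Z.odd_spec: oy => [c ->]; exists c.
have [d zd] : exists d, z = 2 * d + 1 by move/Z.odd_spec: oz => [d ->]; exists d.
(* Modulo 8, (x + y) (x + z) = x^2 + m is 4, so (x + y) / 2 and (x + z) / 2 are both odd and 4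
   divides y - z. *)
have [e cde] : exists e, c - d = 2 * e.
  have P : (a + c + 1) * (a + d + 1) * 4 = x * x + m by rewrite -E /form3 xa yc zd; ring.
  have [q mq] : exists q, m = 8 * q + 3.
    by exists (m / 8); have := Z.div_mod m 8; lia.
  have [w aw] : exists w, a * (a + 1) = 2 * w.
    case: (Z.Even_or_Odd a) => -[w ->]; [exists (w * (2 * w + 1)) | exists ((2 * w + 1) * (w + 1))]; ring.
  have P' : (a + c + 1) * (a + d + 1) = 2 * (w + q) + 1.
    have : x * x = 8 * w + 1 by rewrite xa; lia.
    by lia.
  have : Z.odd ((a + c + 1) * (a + d + 1)) by rewrite P' Z.odd_add Z.odd_mul.
  rewrite Z.odd_mul !Z.odd_add => /andP[A1 A2].
  have : Z.even (c - d).
    rewrite Z.even_sub -!Z.negb_odd.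
    by move: A1 A2; case: (Z.odd a); case: (Z.odd c); case: (Z.odd d).
  exact: Zeven_ex.
have h1 : (y - z) / 2 = 2 * e.
  by rewrite (_ : y - z = 2 * e * 2); [rewrite Z.div_mul | lia].
have h2 : (2 * x + z - z) / 2 = x.
  by rewrite (_ : 2 * x + z - z = x * 2); [rewrite Z.div_mul | lia].
rewrite h1 h2.
have E' : form3 (2 * x + z) (2 * e) z = m.
  by rewrite -E /form3 (_ : y = 4 * e + z); [ring | lia].
have e0 : 0 <= e by lia.
split.
- by rewrite mem_box3; apply/and3P; split; apply/Z.leb_spec0; move: E'; rewrite /form3; nia.
- by congr (_, _, _); lia.
rewrite E' Z.eqb_refl !Z.odd_add !Z.odd_mul oz /=.
rewrite (_ : wt x y z = 4); last by rewrite /wt !Z.sgn_pos.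
(* For y = z the image has middle entry 0 and both sides are 4; otherwise both are 8. *)
case: (Z.eq_dec e 0) => [e1|e1].
  rewrite e1 (_ : y - z = 0); last lia.
  by rewrite /wt (Z.sgn_pos (2 * x + z)) ?(Z.sgn_pos z) //; lia.
rewrite (Z.sgn_pos (y - z)); last lia.
by rewrite /wt (Z.sgn_pos (2 * x + z)) ?(Z.sgn_pos z) ?(Z.sgn_pos (2 * e)) //; lia.
Qed.

(** The two classes with x odd and one even variable are equal and together outweigh the all-odd
    class. The class with x even remains, and it contains (0, 1, m), of weight 2. *)
Lemma class3_pos3 B m : m mod 8 = 3 -> 0 < m -> 3 * m <= Z.of_nat B -> 0 < class3 B m.
Proof.
move=> m8 m0 mB.
have om : Z.odd m.
  rewrite (Z.div_mod m 8) // m8 Z.odd_add Z.odd_mul //.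
rewrite class3_odd // parity_class_swap.
have := parity_class_odd_le m8 m0 mB.
suff : 2 <= parity_class B m false true true by lia.
pose F (t : Z * Z * Z) := let: (x, y, z) := t in
  if [&& form3 x y z =? m, Z.odd x == false, Z.odd y == true & Z.odd z == true]
    then wt x y z else 0.
have F0 t : 0 <= F t.
  by case: t => [[x y] z]; rewrite /F; case: ifP => // _; apply: wt_ge0.
apply: Z.le_trans (@sumZ_ge_term _ (box3 B) F (0, 1, m) _ _ F0).
- rewrite /F om (_ : form3 0 1 m =? m = true); last by rewrite /form3; lia.
  by rewrite /wt (Z.sgn_pos m).
- exact: box3_uniq.
- by rewrite mem_box3; lia.
Qed.

Theorem three_squares (m : Z) : 0 < m ->
  m mod 4 = 1 \/ m mod 4 = 2 \/ m mod 8 = 3 ->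
  exists x y z, m = x * x + y * y + z * z.
Proof.
move=> m0 mm; pose B := Z.to_nat (3 * m).
have mB : 3 * m <= Z.of_nat B by lia.
have : 0 < sqcount B 3 m.
  rewrite three_squares_count //; case: mm => [?|[?|?]].
  - by apply: class3_pos12 => //; left.
  - by apply: class3_pos12 => //; right.
  - exact: class3_pos3.
move=> /= /sumZ_gt0 [x _ /sumZ_gt0 [y _ /sumZ_gt0 [z _]]].
by case: Z.eqb_spec => // E _; exists x, y, z; lia.
Qed.

End ThreeSquares.

(** * The series modulo 32 *)

Section ThueMorse.

Local Open Scope nat_scope.

Lemma s2_ext n N : n <= N -> \sum_(j < N) odd (n %/ expn 2 j) = s2 n.
Proof.
move=> nN; rewrite -(subnKC nN) big_split_ord /= [X in _ + X]big1 ?addn0; first by [].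
move=> j _.
rewrite divn_small //; apply: leq_trans (ltn_expl n (isT : 1 < 2)) _.
by rewrite leq_exp2l // leq_addr.
Qed.

Lemma s2_half n : s2 n = odd n + s2 n./2.
Proof.
case: n => [|n]; first by rewrite /s2 !big_ord0.
rewrite -(@s2_ext n.+1 n.+1) // big_ord_recl expn0 divn1; congr (_ + _).
rewrite -(@s2_ext n.+1./2 n); last by rewrite -divn2; lia.
by apply: eq_bigr => j _; rewrite lift0 expnS divnMA divn2.
Qed.

Definition tm (n : nat) : Z := if odd (s2 n) then (-1)%Z else 1%Z.

Lemma tm_double n : tm n.*2 = tm n.
Proof. by rewrite /tm s2_half odd_double doubleK. Qed.

Lemma tm_doubleS n : tm n.*2.+1 = Z.opp (tm n).
Proof.
rewrite /tm s2_half /= odd_double uphalf_double /=.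
by case: (odd (s2 n)).
Qed.

Lemma tm_values : ((tm 0 = 1%Z) * (tm 1 = (-1)%Z) * (tm 2 = (-1)%Z) * (tm 3 = 1%Z)
  * (tm 4 = (-1)%Z) * (tm 5 = 1%Z) * (tm 6 = 1%Z) * (tm 7 = (-1)%Z))%type.
Proof.
have t0 : tm 0 = 1%Z by rewrite /tm /s2 big_ord0.
have t1 : tm 1 = (-1)%Z by rewrite (tm_doubleS 0) t0.
have t2 : tm 2 = (-1)%Z by rewrite (tm_double 1) t1.
have t3 : tm 3 = 1%Z by rewrite (tm_doubleS 1) t1.
by do !split; rewrite // ?(tm_double 2) ?(tm_doubleS 2) ?(tm_double 3) ?(tm_doubleS 3) ?t2 ?t3.
Qed.

Lemma tm_sqr n : tm n = 1%Z \/ tm n = (-1)%Z.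
Proof. by rewrite /tm; case: ifP; [right|left]. Qed.

Lemma t_tm n : t n = int_of_Z (tm n).
Proof. by rewrite /t /tm -signr_odd; case: (odd _). Qed.

(* With T(x) the series of tm, psi is the series T(x) / (1 + x) and twist is the
   series M(x) with M(x) = (1 - x) (M(x^2) + x psi(x^2)). *)
Fixpoint psi (n : nat) : Z :=
  if n is n'.+1 then (tm n'.+1 - psi n')%Z else 1%Z.

Fixpoint twist_fuel (k n : nat) : Z :=
  if k is k'.+1 then
    if n is 0 then 0%Z else
    if odd n then (psi n./2 - twist_fuel k' n./2)%Z
    else (twist_fuel k' n./2 - psi n./2.-1)%Z
  else 0%Z.

Definition twist (n : nat) : Z := twist_fuel n n.

Lemma twist_fuelE k n : n <= k -> twist_fuel k n = twist n.
Proof.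
suff H j : forall i m, m <= i -> m <= j -> twist_fuel i m = twist_fuel j m.
  by move=> nk; apply: H.
elim: j => [|j IH] [|i] [|m] //= mi mj.
by case: ifP => _; rewrite (IH i) //; lia.
Qed.

Lemma twist_half n : 0 < n ->
  twist n = if odd n then (psi n./2 - twist n./2)%Z else (twist n./2 - psi n./2.-1)%Z.
Proof.
case: n => // n _; rewrite -(@twist_fuelE n n.+1./2) //.
by rewrite -divn2; lia.
Qed.

Lemma twist_doubleS n : twist n.*2.+1 = (psi n - twist n)%Z.
Proof. by rewrite twist_half //= odd_double /= uphalf_double. Qed.

Lemma twist_double n : twist n.+1.*2 = (twist n.+1 - psi n)%Z.
Proof. by rewrite twist_half // odd_double doubleK. Qed.

(* The coefficients of x ^ (m + 4) in (1 - x) ^ 4 f and in the series to which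
   the generating function of b_3 is congruent modulo 32. *)
Definition diff4 (f : nat -> Z) (m : nat) : Z :=
  (f m.+4 - 4 * f m.+3 + 6 * f m.+2 - 4 * f m.+1 + f m)%Z.

Definition model (m : nat) : Z := (diff4 tm m + 8 * diff4 twist m)%Z.

(** With an explicit quotient, congruences are combined and checked by [ring]. *)
Definition congZ (k a c : Z) : Prop := exists d, (a = c + k * d)%Z.

Lemma psiS n : psi n.+1 = (tm n.+1 - psi n)%Z. Proof. by []. Qed.

(** The equation (1 - x)^3 B(x) = B(x^2) at x^(2 i + 8), with [model m] in the place of b_3(m + 4).
    The doubling rules make the difference a linear expression divisible by 32, and the witness is
    its quotient. *)
Lemma model_even i : congZ 32 (model i.*2.+4)
  (3 * model i.*2.+3 - 3 * model i.*2.+2 + model i.*2.+1 + model i).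
Proof.
exists (- tm i.+3 - 10 * tm i.+2 - tm i.+1
        + 8 * twist i.+3 + 16 * twist i.+2 + 8 * twist i.+1)%Z.
rewrite /model /diff4.
have := (tm_doubleS i, tm_doubleS i.+1, tm_doubleS i.+2, tm_doubleS i.+3).
have := (tm_double i.+1, tm_double i.+2, tm_double i.+3, tm_double i.+4).
have := (twist_doubleS i, twist_doubleS i.+1, twist_doubleS i.+2, twist_doubleS i.+3).
have := (twist_double i, twist_double i.+1, twist_double i.+2, twist_double i.+3).
rewrite !doubleS !psiS => -[[[-> ->] ->] ->] [[[-> ->] ->] ->] [[[-> ->] ->] ->] [[[-> ->] ->] ->].
by ring.
Qed.

Lemma model_odd i : congZ 32 (model i.*2.+4.+1)
  (3 * model i.*2.+4 - 3 * model i.*2.+3 + model i.*2.+2).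
Proof.
exists (5 * tm i.+3 + 9 * tm i.+2 - 4 * tm i.+1 + 4 * psi i
        - 2 * twist i.+4 - 14 * twist i.+3 - 14 * twist i.+2 - 2 * twist i.+1)%Z.
rewrite /model /diff4.
have := (tm_doubleS i.+1, tm_doubleS i.+2, tm_doubleS i.+3, tm_doubleS i.+4).
have := (tm_double i.+1, tm_double i.+2, tm_double i.+3, tm_double i.+4).
have := (twist_doubleS i.+1, twist_doubleS i.+2, twist_doubleS i.+3, twist_doubleS i.+4).
have := (twist_double i, twist_double i.+1, twist_double i.+2, twist_double i.+3).
rewrite !doubleS !psiS => -[[[-> ->] ->] ->] [[[-> ->] ->] ->] [[[-> ->] ->] ->] [[[-> ->] ->] ->].
by ring.
Qed.

(** Four values are compared directly, because the recurrences for [model] start at index 4. *)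
Lemma model_unique (f : nat -> Z) :
    f 0 = 1%Z -> f 1 = 3%Z -> f 2 = 9%Z ->
    (forall n, f n.+3 = (3 * f n.+2 - 3 * f n.+1 + f n
                + if odd n.+3 then 0 else f (n.+3)./2)%Z) ->
  forall n, congZ 32 (f n.+4) (model n).
Proof.
move=> f0 f1 f2 fS; elim/ltn_ind => n IH.
have f3 : f 3 = 19%Z by rewrite fS /= f0 f1 f2.
have f4 : f 4 = 42%Z by rewrite fS /= f1 f2 f3.
have f5 : f 5 = 78%Z by rewrite fS /= f2 f3 f4.
have f6 : f 6 = 146%Z by rewrite fS /= f3 f4 f5.
have f7 : f 7 = 246%Z by rewrite fS /= f4 f5 f6.
case: (ltnP n 4) => [|n4].
  case: n {IH} => [|[|[|[|//]]]] _; rewrite ?f4 ?f5 ?f6 ?f7.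
  - by exists (-1)%Z; rewrite /model /diff4 /twist /= !tm_values.
  - by exists 8%Z; rewrite /model /diff4 /twist /= !tm_values.
  - by exists 1%Z; rewrite /model /diff4 /twist /= !tm_values.
  - by exists 4%Z; rewrite /model /diff4 /twist /= !tm_values.
have [i [ni|ni]] : exists i, n = i.*2.+4 \/ n = i.*2.+4.+1.
  by exists (n - 4)./2; rewrite -divn2; lia.
- have [d dE] := model_even i.
  have [d1 E1] := IH i.*2.+3 ltac:(lia); have [d2 E2] := IH i.*2.+2 ltac:(lia).
  have [d3 E3] := IH i.*2.+1 ltac:(lia); have [d4 E4] := IH i ltac:(lia).
  exists (3 * d1 - 3 * d2 + d3 + d4 - d)%Z; rewrite ni fS E1 E2 E3 dE.
  have -> : odd i.*2.+4.+4 = false by rewrite /= odd_double.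
  have -> : (i.*2.+4.+4)./2 = i.+4 by rewrite /= doubleK.
  by rewrite E4; ring.
- have [d dE] := model_odd i.
  have [d1 E1] := IH i.*2.+4 ltac:(lia); have [d2 E2] := IH i.*2.+3 ltac:(lia).
  have [d3 E3] := IH i.*2.+2 ltac:(lia).
  exists (3 * d1 - 3 * d2 + d3 - d)%Z; rewrite ni fS E1 E2 E3 dE.
  have -> : odd i.*2.+4.+1.+4 = true by rewrite /= odd_double.
  by ring.
Qed.

End ThueMorse.

(** * Residues modulo 32 *)

Section Residues.

Local Open Scope nat_scope.

(** An alternating sum of n + 1 terms, each 1 or -1. *)
Lemma psi_parity n : exists c, psi n = (Z.of_nat n + 1 + 2 * c)%Z.
Proof.
elim: n => [|n [c IH]]; first by exists 0%Z.
rewrite psiS IH; case: (tm_sqr n.+1) => ->.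
  by exists (- Z.of_nat n - 1 - c)%Z; lia.
by exists (- Z.of_nat n - 2 - c)%Z; lia.
Qed.

(** The arguments involved share all but the last two binary digits with 4 k or 4 (k + 1). *)
Lemma diff4_tm k :
  [/\ diff4 tm k.*2.*2 = (tm k.+1 - 5 * tm k)%Z,
      diff4 tm k.*2.*2.+1 = (- 5 * tm k.+1 + 9 * tm k)%Z,
      diff4 tm k.*2.*2.+2 = (9 * tm k.+1 - 5 * tm k)%Z &
      diff4 tm k.*2.*2.+3 = (- 5 * tm k.+1 + tm k)%Z].
Proof.
rewrite /diff4.
have := (tm_double k, tm_doubleS k, tm_double k.+1, tm_doubleS k.+1).
have := (tm_double k.*2, tm_doubleS k.*2, tm_double k.*2.+1, tm_doubleS k.*2.+1).
have := (tm_double k.*2.+2, tm_doubleS k.*2.+2, tm_double k.*2.+3, tm_doubleS k.*2.+3).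
rewrite !doubleS => -[[[-> ->] ->] ->] [[[-> ->] ->] ->] [[[-> ->] ->] ->].
by split; ring.
Qed.

(** Two uses of the functional equation of M bring the indices down to k + 1 and k + 2. *)
Lemma diff4_twist k : let L := k.*2 in
  [/\ diff4 twist L.*2.+4 = (twist k.+2 - 5 * twist k.+1 + 9 * tm k.+1
          - 14 * psi k + 4 * psi L.+1)%Z,
      diff4 twist L.*2.+4.+1 = (tm k.+2 - 18 * tm k.+1 + 4 * psi L.+1
          - 5 * twist k.+2 + 6 * psi k + 9 * twist k.+1)%Z,
      diff4 twist L.*2.+4.+2 = (3 * tm k.+1 + 6 * psi k + 9 * twist k.+2
          - 4 * psi L.+1 - 4 * tm k.+2 - 5 * twist k.+1)%Z &
      diff4 twist L.*2.+4.+3 = (3 * tm k.+2 + 22 * tm k.+1 - 4 * psi L.+1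
          - 14 * psi k - 5 * twist k.+2 + twist k.+1)%Z].
Proof.
move=> L; rewrite /diff4.
have := (twist_double k, twist_doubleS k.+1, twist_double k.+1, twist_doubleS k.+2).
have := (tm_double k.+1, tm_doubleS k.+1, tm_double k.+2, tm_doubleS k.+2).
have := (twist_double L.+1, twist_doubleS L.+2, twist_double L.+2, twist_doubleS L.+3).
have := (twist_double L.+3, twist_doubleS L.+4, twist_double L.+4, twist_doubleS L.+4.+1).
rewrite !doubleS -/L => -[[[-> ->] ->] ->] [[[-> ->] ->] ->].
rewrite !(psiS k.+1) !(psiS k) (psiS L.+4) (psiS L.+3) (psiS L.+2) (psiS L.+1).
move=> [[[-> ->] ->] ->] [[[-> ->] ->] ->].
by split; ring.
Qed.

Section OddPart.

Variable l : nat.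

Let q (v : nat) := expn 2 v * l.*2.+1.

Lemma q_gt0 v : 0 < q v. Proof. by rewrite /q muln_gt0 expn_gt0. Qed.

Lemma qS v : q v.+1 = (q v).*2.
Proof. by rewrite /q expnS -mulnA mul2n. Qed.

Lemma tm_q v : tm (q v) = (- tm l)%Z.
Proof.
elim: v => [|v IH]; first by rewrite /q mul1n tm_doubleS.
by rewrite qS tm_double.
Qed.

(** Subtracting 1 turns the final digits 1 0...0 into 0 1...1, with v repetitions, and changes the
    digit sum by v - 1. *)
Lemma tm_q_pred v : tm (q v).-1 = if odd v then tm (q v) else (- tm (q v))%Z.
Proof.
elim: v => [|v]; first by rewrite tm_q /q mul1n /= tm_double Z.opp_involutive.
rewrite qS tm_double; case: (q v) (q_gt0 v) => // r _ IH.
rewrite doubleS /= tm_doubleS IH /=.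
by case: (odd v); rewrite ?Z.opp_involutive.
Qed.

(** Doubling carries each combination to the other, with an extra - 2 [psi r] from even to odd v,
    where r + 1 = q v. Modulo 4 this is 2 q v, nonzero only at v = 0. *)
Lemma twist_q v : congZ 4
  (if odd v then twist (q v) - twist (q v).-1 else twist (q v) + twist (q v).-1)%Z
  (tm l + 2 * Z.of_nat l + if v is O then 0 else 2)%Z.
Proof.
elim: v => [|v].
  rewrite /q mul1n /= twist_doubleS.
  case: l => [|m].
    by exists 0%Z; rewrite [twist 0.*2]/= [psi 0]/= tm_values.
  rewrite twist_double psiS; have [c ->] := psi_parity m.
  by exists (- Z.of_nat m - 1 - c)%Z; lia.
have [r rE] : exists r, q v = r.+1 by exists (q v).-1; rewrite prednK ?q_gt0.
rewrite qS rE doubleS [r.+1.-1]/= [_.+2.-1]/=.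
have := (twist_double r, twist_doubleS r); rewrite doubleS => -[-> ->].
have [c ->] := psi_parity r; rewrite [odd v.+1]/=.
case ov: (odd v) => /= -[d dE].
  case: (v) ov dE => // v' _ dE.
  by exists d; lia.
case: v rE ov dE => [|v'] rE ov dE.
  exists (d - Z.of_nat l - 1 - c)%Z.
  by move: rE; rewrite /q mul1n => -[?]; lia.
move: rE; rewrite qS => rE.
by exists (d - Z.of_nat (q v') - c)%Z; lia.
Qed.

(** For v even [tm] changes sign from q - 1 to q, so [diff4 tm] is 6 or 14 up to sign. The index 4
    (q - 1) + i belongs to n = 4 q + i. *)
Lemma model_even_val v i : ~~ odd v -> i < 4 ->
  congZ 4 (model ((q v).-1.*2.*2 + i)) 2.
Proof.
move=> ev; rewrite /model; have := tm_q_pred v; rewrite (negbTE ev).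
case: (q v) (q_gt0 v) => // k _ /= E.
have [D0 D1 D2 D3] := diff4_tm k; have := tm_sqr k.+1.
case: i => [|[|[|[|//]]]] H _; rewrite ?addn0 ?addn1 ?addn2 ?addn3.
- rewrite D0 E; case: H => ->; [exists (1 + 2 * diff4 twist k.*2.*2)%Z |
    exists (-2 + 2 * diff4 twist k.*2.*2)%Z]; ring.
- rewrite D1 E; case: H => ->; [exists (-4 + 2 * diff4 twist k.*2.*2.+1)%Z |
    exists (3 + 2 * diff4 twist k.*2.*2.+1)%Z]; ring.
- rewrite D2 E; case: H => ->; [exists (3 + 2 * diff4 twist k.*2.*2.+2)%Z |
    exists (-4 + 2 * diff4 twist k.*2.*2.+2)%Z]; ring.
- rewrite D3 E; case: H => ->; [exists (-2 + 2 * diff4 twist k.*2.*2.+3)%Z |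
    exists (1 + 2 * diff4 twist k.*2.*2.+3)%Z]; ring.
Qed.

(** The residue of b_3(4 q + i) for v odd, with [tq] the Thue-Morse sign of q and [chi] = (-1)^l;
    always 4 times an odd number. *)
Definition residue (i : nat) (tq chi : Z) : Z :=
  match i with
  | 0%N => - 4 * tq + 8 * (3 + chi)
  | 1%N => 4 * tq + 8 * (1 - chi)
  | 2%N => 4 * tq + 8 * (1 + chi)
  | _ => - 4 * tq + 8 * (3 - chi)
  end%Z.

(** For v odd [tm] agrees at q - 1 and q, so [diff4 tm] is 4 up to sign. There remains [diff4 twist]
    modulo 4, obtained from [twist_q] and the parity of l. *)
Lemma model_odd_val v i : odd v -> i < 4 ->
  congZ 32 (model ((q v).-1.*2.*2 + i))
           (residue i (tm (q v)) (if odd l then -1 else 1)%Z).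
Proof.
move=> ov i4; rewrite /model.
have := twist_q v; rewrite ov; have := tm_q_pred v; rewrite ov.
have := tm_q v; have : 1 < q v /\ ~~ odd (q v).
  by case: v ov => // v _; rewrite qS odd_double; have := q_gt0 v; lia.
case: v ov => // v _.
case: (q v.+1) => [|[|k]] [] // _; rewrite /= negbK => ek Et Ep [g gE].
have [D0 D1 D2 D3] := diff4_tm k.+1; have [T0 T1 T2 T3] := diff4_twist k.
have [c pE] := psi_parity k.
have kE : Z.of_nat k = (2 * Z.of_nat k./2)%Z by rewrite -divn2; lia.
pose eps := (if odd l then 1 else 0)%Z.
have lE : (Z.of_nat l = 2 * Z.of_nat l./2 + eps)%Z.
  by rewrite /eps -divn2; case: (boolP (odd l)); lia.
have -> : (if odd l then -1 else 1)%Z = (1 - 2 * eps)%Z by rewrite /eps; case: ifP.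
(* Here q = k + 2; after this substitution [twist k.+1] occurs only with coefficients divisible by
   4. *)
have wE : twist k.+2 = (twist k.+1 - tm k.+2 + 2 * Z.of_nat l + 2 + 4 * g)%Z by lia.
move: D0 D1 D2 D3 T0 T1 T2 T3; rewrite !doubleS Ep wE pE kE lE.
set w := twist k.+1; set Psi := psi k.*2.+1; set l2 := Z.of_nat l./2.
set k2 := Z.of_nat k./2; move=> D0 D1 D2 D3 T0 T1 T2 T3.
case: i i4 => [|[|[|[|//]]]] _; rewrite /residue ?addn0 ?addn1 ?addn2 ?addn3.
- rewrite D0 T0.
  by exists (- w + 2 * tm k.+2 + l2 + eps + g - 7 * k2 - 7 * c + Psi - 4)%Z; ring.
- rewrite D1 T1.
  by exists (- 3 * tm k.+2 + Psi + w - 5 * l2 - 3 * eps - 1 - 5 * g + 3 * k2 + 3 * c)%Z; ring.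
(* A term congruent to 16 t with t = 1 or -1 is left; it is 16 modulo 32, but the quotient depends
   on t. *)
- rewrite D2 T2; case: (tm_sqr k.+2) => ->.
    by exists (3 + 3 * k2 + 3 * c + w + 9 * l2 + 5 * eps + 9 * g - Psi)%Z; ring.
  by exists (8 + 3 * k2 + 3 * c + w + 9 * l2 + 5 * eps + 9 * g - Psi)%Z; ring.
- rewrite D3 T3; case: (tm_sqr k.+2) => ->.
    by exists (1 - Psi - 7 * k2 - 7 * c - w - 5 * l2 - 3 * eps - 5 * g)%Z; ring.
  by exists (- 14 - Psi - 7 * k2 - 7 * c - w - 5 * l2 - 3 * eps - 5 * g)%Z; ring.
Qed.

End OddPart.

End Residues.

(** * The recurrence for b_3 *)

Section GeneratingPolynomial.

Local Open Scope ring_scope.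

(** The first N terms of 1 / (1 - x^d). *)
Definition geo (N d : nat) : {poly int} := \sum_(k < N) 'X^(k * d).

Definition colored_gen (N : nat) : {poly int} := \prod_(j < N) geo N (expn 2 j).

(** Expanding the product picks one exponent for each color and power of two, that is, a
    multiplicity function [c]. *)
Lemma b_coef m n : (b m n)%:Z = (colored_gen n.+1 ^+ m)`_n.
Proof.
have -> : colored_gen n.+1 ^+ m =
    \prod_(ij : 'I_m * 'I_n.+1) \sum_(k < n.+1) 'X^(k * expn 2 ij.2).
  rewrite -(pair_big xpredT xpredT (fun (i : 'I_m) (j : 'I_n.+1) => geo n.+1 (expn 2 j))) /=.
  by rewrite prodr_const card_ord.
rewrite bigA_distr_bigA coef_sum /b -sum1_card big_mkcond /=.
rewrite (big_morph Posz PoszD (erefl 0%:Z)); apply: eq_bigr => c _.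
rewrite -(big_morph _ (exprD 'X) (expr0 'X)) coefXn inE eq_sym.
by case: (_ == _).
Qed.

Lemma coef_geo N d i : (i < N)%N -> (0 < d)%N -> (geo N d)`_i = (d %| i)%:R.
Proof.
move=> iN d0; rewrite /geo coef_sum.
under eq_bigr => k _ do rewrite coefXn.
case: (boolP (d %| i)%N) => [/dvdnP[k ik]|di].
  have kN : (k < N)%N by apply: leq_ltn_trans iN; rewrite ik leq_pmulr.
  rewrite (bigD1 (Ordinal kN)) //= ik eqxx big1 ?addr0 // => j /eqP jk.
  rewrite eqn_pmul2r //; case: eqP => // kj; case: jk.
  by apply: val_inj; rewrite /= kj.
rewrite big1 // => k _; case: eqP => // ik.
by move: di; rewrite ik dvdn_mull.
Qed.

Definition eq_upto (N : nat) (p r : {poly int}) := forall i, (i < N)%N -> p`_i = r`_i.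

Lemma eq_uptoM N p p' r r' : eq_upto N p p' -> eq_upto N r r' -> eq_upto N (p * r) (p' * r').
Proof.
move=> pp rr i iN; rewrite !coefM; apply: eq_bigr => j _.
by rewrite pp ?rr //; apply: leq_ltn_trans iN; [exact: leq_subr | rewrite -ltnS].
Qed.

Lemma eq_uptoX N p p' k : eq_upto N p p' -> eq_upto N (p ^+ k) (p' ^+ k).
Proof. by move=> pp; elim: k => // k IH; rewrite !exprS; apply: eq_uptoM. Qed.

Lemma eq_upto_prod N (F G : nat -> {poly int}) k :
  (forall j, eq_upto N (F j) (G j)) ->
  eq_upto N (\prod_(j < k) F j) (\prod_(j < k) G j).
Proof.
by move=> FG; elim: k => [|k IH]; rewrite ?big_ord0 // !big_ord_recr; apply: eq_uptoM.
Qed.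

Lemma geo_large N M j : (N <= M)%N -> (N <= j)%N -> eq_upto N (geo M (expn 2 j)) 1.
Proof.
move=> NM Nj i iN; rewrite coef_geo ?expn_gt0 ?(leq_trans iN) // coef1.
case: i iN => [|i] iN; first by rewrite dvdn0.
rewrite gtnNdvd //; apply: leq_trans iN _; apply: leq_trans Nj _.
by apply: ltnW; apply: ltn_expl.
Qed.

(** Allows values of [b] with different bounds to be read off one polynomial. *)
Lemma colored_gen_trunc N M : (N <= M)%N -> eq_upto N (colored_gen M) (colored_gen N).
Proof.
move=> NM; rewrite /colored_gen -(big_mkord xpredT (fun j => geo M (expn 2 j))).
rewrite (@big_cat_nat _ _ _ N) //= big_mkord.
rewrite -[X in eq_upto _ _ X]mulr1; apply: eq_uptoM.
  apply: (@eq_upto_prod N (fun j => geo M (expn 2 j)) (fun j => geo N (expn 2 j))).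
  by move=> j i iN; rewrite !coef_geo ?expn_gt0 ?(leq_trans iN).
rewrite big_nat; apply: (big_ind (fun p => eq_upto N p 1)) => // [p r p1 r1|j /andP[Nj _]].
  by rewrite -(mulr1 1); apply: eq_uptoM.
exact: geo_large.
Qed.

Lemma b_colored_gen m n N : (n < N)%N -> (b m n)%:Z = (colored_gen N ^+ m)`_n.
Proof.
by move=> nN; rewrite b_coef (eq_uptoX m (colored_gen_trunc nN)).
Qed.

Lemma geo_comp N d : geo N d \Po 'X^2 = geo N (d * 2).
Proof.
rewrite /geo raddf_sum /=; apply: eq_bigr => k _.
by rewrite comp_Xn_poly -exprM; congr (_ ^+ _); lia.
Qed.

(** The factor 1 - x cancels j = 0, and substituting x^2 shifts j by one; the new last factor is 1
    below degree N. *)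
Lemma colored_gen_rec N :
  eq_upto N ((1 - 'X) * colored_gen N) (colored_gen N \Po 'X^2).
Proof.
case: N => // N.
have -> : colored_gen N.+1 \Po 'X^2 = \prod_(j < N.+1) geo N.+1 (expn 2 j.+1).
  rewrite /colored_gen rmorph_prod; apply: eq_bigr => j _.
  by rewrite expnSr -geo_comp.
rewrite big_ord_recr /= [X in eq_upto _ _ X]mulrC.
rewrite /colored_gen big_ord_recl mulrA; apply: eq_uptoM; last by [].
move=> i iN; rewrite [RHS](geo_large (leqnn _) (leqnn _)) //.
rewrite expn0 coef1 mulrBl mul1r coefB coefXM !coef_geo //; last by lia.
by case: i iN => [|i] iN; rewrite ?dvd1n // subrr.
Qed.

Lemma coef_1subX (p : {poly int}) i : ((1 - 'X) * p)`_i.+1 = p`_i.+1 - p`_i.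
Proof. by rewrite mulrBl mul1r coefB coefXM. Qed.

Lemma coef_1subX0 (p : {poly int}) : ((1 - 'X) * p)`_0 = p`_0.
Proof. by rewrite mulrBl mul1r coefB coefXM subr0. Qed.

(** The cube of the functional equation; the factors 1 - x are kept apart so that each yields a
    difference of coefficients. *)
Lemma b3_diff n : let C := colored_gen n.+4 ^+ 3 in
  forall i, (i < n.+4)%N ->
  ((1 - 'X) * ((1 - 'X) * ((1 - 'X) * C)))`_i = if odd i then 0 else (b 3 i./2)%:Z.
Proof.
move=> C i iN.
have -> : (1 - 'X) * ((1 - 'X) * ((1 - 'X) * C)) = ((1 - 'X) * colored_gen n.+4) ^+ 3.
  by rewrite exprMn /C [(1 - 'X) ^+ 3]exprS expr2 !mulrA.
rewrite (eq_uptoX 3 (@colored_gen_rec n.+4)) // -rmorphXn coef_comp_poly_Xn //.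
rewrite dvdn2 -divn2; case: (odd i) => //=.
by rewrite (@b_colored_gen 3 _ n.+4) //; apply: leq_ltn_trans (leq_div _ _) iN.
Qed.

Definition bz (n : nat) : Z := Z_of_int (b 3 n)%:Z.

Lemma bz0 : bz 0 = 1%Z.
Proof.
by rewrite /bz b_coef /colored_gen big_ord1 /geo big_ord1 mul0n expr0 expr1n coef1.
Qed.

Lemma bz_rec n : bz n.+3 = (3 * bz n.+2 - 3 * bz n.+1 + bz n
  + if odd n.+3 then 0 else bz (n.+3)./2)%Z.
Proof.
have := @b3_diff n n.+3 (ltnSn _).
rewrite !coef_1subX -!b_colored_gen //; try by lia.
rewrite /bz; case: ifP => _; lia.
Qed.

Lemma bz1 : bz 1 = 3%Z.
Proof.
have := @b3_diff 0 1 isT; rewrite !(coef_1subX, coef_1subX0) -!b_colored_gen //=.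
by have := bz0; rewrite /bz; lia.
Qed.

Lemma bz2 : bz 2 = 9%Z.
Proof.
have := @b3_diff 0 2 isT; rewrite !(coef_1subX, coef_1subX0) -!b_colored_gen //=.
by have := bz0; have := bz1; rewrite /bz; lia.
Qed.

End GeneratingPolynomial.

(** * Classification *)

Section Classification.

Local Open Scope Z_scope.

Definition sum3 (a : Z) : Prop := exists x y z, a = x * x + y * y + z * z.

Lemma in_S_sum3 n : in_S 3 n <-> ~ sum3 (bz n).
Proof.
split=> H [x [y [z E]]]; apply: H.
  exists (int_of_Z x), (int_of_Z y), (int_of_Z z).
  by move: E; rewrite /bz !expr2; lia.
exists (Z_of_int x), (Z_of_int y), (Z_of_int z).
by move: E; rewrite /bz !expr2; lia.
Qed.

Lemma sqr_mod8 x : exists c, [\/ x * x = 8 * c, x * x = 8 * c + 1 | x * x = 8 * c + 4].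
Proof.
have [k [->|[->|[->|->]]]] : exists k,
    x = 4 * k \/ x = 4 * k + 1 \/ x = 4 * k + 2 \/ x = 4 * k + 3.
  by exists (x / 4); have := Z.div_mod x 4; have := Z.mod_pos_bound x 4; lia.
- by exists (2 * k * k); constructor 1; ring.
- by exists (2 * k * k + k); constructor 2; ring.
- by exists (2 * k * k + 2 * k); constructor 3; ring.
- by exists (2 * k * k + 3 * k + 1); constructor 2; ring.
Qed.

(** A sum of three squares divisible by 4 has even terms only; halving them would represent a number
    that is 7 modulo 8. *)
Lemma not_sum3 a : congZ 32 a 28 -> ~ sum3 a.
Proof.
move=> [d ->] [x [y [z E]]].
have half u : exists h e, [/\ u = 2 * h + e, 0 <= e <= 1 & u * u = 4 * (h * h + h * e) + e].
  exists (u / 2), (u mod 2).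
  have := Z.div_mod u 2; have := Z.mod_pos_bound u 2; split; [lia | lia |].
  have -> : u * u = (2 * (u / 2) + u mod 2) * (2 * (u / 2) + u mod 2).
    by congr (_ * _); lia.
  have : u mod 2 * (u mod 2) = u mod 2 by nia.
  by move: (u / 2) (u mod 2) => h e ee; lia.
have [x1 [ex [_ ex1 Ex]]] := half x; have [y1 [ey [_ ey1 Ey]]] := half y.
have [z1 [ez [_ ez1 Ez]]] := half z.
have [ex0 ey0 ez0] : [/\ ex = 0, ey = 0 & ez = 0] by split; lia.
have E1 : x1 * x1 + y1 * y1 + z1 * z1 = 7 + 8 * d.
  by move: E; rewrite Ex Ey Ez ex0 ey0 ez0; lia.
have [cx Cx] := sqr_mod8 x1; have [cy Cy] := sqr_mod8 y1; have [cz Cz] := sqr_mod8 z1.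
move: E1 Cx Cy Cz; clear; move: (x1 * x1) (y1 * y1) (z1 * z1) => X Y Z0 E.
by case=> ?; case=> ?; case=> ?; lia.
Qed.

Lemma sum3_mod4 a : 0 <= a -> congZ 4 a 2 -> sum3 a.
Proof.
move=> a0 [d aE]; apply: three_squares; first by lia.
by right; left; rewrite aE Z.mul_comm Z.mod_add.
Qed.

(** Doubles a representation of a / 4, which is 1, 3 or 5 modulo 8. *)
Lemma sum3_mod32 a c : 0 <= a -> congZ 32 a (4 * c) -> c = 1 \/ c = 3 \/ c = 5 -> sum3 a.
Proof.
move=> a0 [d aE] cE.
have m0 : 0 < c + 8 * d by lia.
have [x [y [z E]]] : sum3 (c + 8 * d).
  apply: three_squares => //.
  case: cE => [->|[->|->]].
  - by left; rewrite (_ : 8 * d = 2 * d * 4) ?Z.mod_add //; ring.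
  - by right; right; rewrite Z.mul_comm Z.mod_add.
  - by left; rewrite (_ : 8 * d = 2 * d * 4) ?Z.mod_add //; ring.
by exists (2 * x), (2 * y), (2 * z); lia.
Qed.

Lemma bz_ge0 n : 0 <= bz n.
Proof. by rewrite /bz; lia. Qed.

Lemma bz_model n : congZ 32 (bz n.+4) (model n).
Proof. exact: (model_unique bz0 bz1 bz2 bz_rec). Qed.

(* The cases in which residue i (- tl) (-1)^l is 28 modulo 32. *)
Definition exceptional (i : nat) (tl : Z) (lodd : bool) : Prop :=
  match i with
  | 0%N => tl = -1 /\ ~~ lodd
  | 1%N => tl = 1 /\ ~~ lodd
  | 2%N => tl = 1 /\ lodd
  | _ => tl = -1 /\ lodd
  end.

Lemma in_S_classified (v l i : nat) : (i < 4)%N ->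
  in_S 3 (4 * (expn 2 v * l.*2.+1) + i)%N <-> odd v /\ exceptional i (tm l) (odd l).
Proof.
move=> i4; rewrite in_S_sum3; set q := (expn 2 v * l.*2.+1)%N.
have q0 : (0 < q)%N := q_gt0 l v.
have nE : (4 * q + i = (q.-1.*2.*2 + i).+4)%N by lia.
have := bz_model (q.-1.*2.*2 + i); rewrite -nE => -[d dE].
have b0 : 0 <= bz (4 * q + i)%N by exact: bz_ge0.
case: (boolP (odd v)) => ov; last first.
  split=> [[]|[]//]; apply: sum3_mod4 => //.
  have [e eE] := model_even_val l ov i4.
  by exists (e + 8 * d); rewrite dE eE; ring.
have [e] := model_odd_val l ov i4; rewrite tm_q -/q => eE.
have {eE}E : congZ 32 (bz (4 * q + i)%N) (residue i (- tm l) (if odd l then -1 else 1)).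
  by exists (e + d); rewrite dE eE; ring.
move: E b0; move: (bz _) => a E a0.
have S (c : Z) : residue i (- tm l) (if odd l then -1 else 1) = 28 + 32 * c ->
    exceptional i (tm l) (odd l) ->
    (~ sum3 a <-> true /\ exceptional i (tm l) (odd l)).
  move=> rE ex; split=> // _; apply: not_sum3.
  by move: E => [f ->]; exists (f + c); rewrite rE; ring.
have N (c r : Z) : residue i (- tm l) (if odd l then -1 else 1) = 4 * r + 32 * c ->
    r = 1 \/ r = 3 \/ r = 5 -> ~ exceptional i (tm l) (odd l) ->
    (~ sum3 a <-> true /\ exceptional i (tm l) (odd l)).
  move=> rE r1 nex; split=> [[]|[]//].
  apply: (@sum3_mod32 _ r) => //.
  by move: E => [f ->]; exists (f + c); rewrite rE; ring.
clear E dE nE.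
(* Sixteen cases for i, t_l and the parity of l: [S] where the residue is 28, and [N] where a
   quarter of it is 1, 3 or 5 modulo 8. *)
case: i i4 S N => [|[|[|[|//]]]] _ /=; case: (tm_sqr l) => ->; case: (odd l) => S N.
- by apply: (N 0 5) => //; [right; right | case].
- by apply: (N 1 1) => //; [left | case].
- by apply: (N 0 3) => //; [right; left | case].
- by apply: (S (0)).
- by apply: (N 0 3) => //; [right; left | case].
- by apply: (S (-1)).
- by apply: (N 0 5) => //; [right; right | case].
- by apply: (N 0 1) => //; [left | case].
- by apply: (S (-1)).
- by apply: (N 0 3) => //; [right; left | case].
- by apply: (N 0 1) => //; [left | case].
- by apply: (N 0 5) => //; [right; right | case].
- by apply: (N 1 1) => //; [left | case].
- by apply: (N 0 5) => //; [right; right | case].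
- by apply: (S (0)).
- by apply: (N 0 3) => //; [right; left | case].
Qed.

End Classification.

(** * The explicit form of n *)

Section Parametrization.

Local Open Scope nat_scope.

(** The bracket of the theorem, to be identified with the odd part 2 l + 1 of n / 4 rounded down. *)
Definition odd_part_formula (i p : nat) : int :=
  ((8 * p)%:Z + 2%:Z * (i %/ 2)%N%:Z + 3%:Z + 2%:Z * (-1) ^+ i * t p)%R.

Lemma tm_quad p : [/\ tm (4 * p) = tm p, tm (4 * p + 1) = (- tm p)%Z,
  tm (4 * p + 2) = (- tm p)%Z & tm (4 * p + 3) = tm p].
Proof.
have -> : 4 * p = p.*2.*2 by lia.
rewrite addn1 addn2 addn3 -doubleS !tm_doubleS !tm_double !tm_doubleS.
by rewrite Z.opp_involutive.
Qed.

(** The condition prescribes the parity of l and t_l. Comparing t_l with t_p for p = l / 4 rounded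
    down gives the second binary digit of l, hence 2 l + 1 modulo 8. *)
Lemma odd_part_formulaP i l : i < 4 -> exceptional i (tm l) (odd l) ->
  odd_part_formula i (l %/ 4) = Posz l.*2.+1.
Proof.
move=> i4; have : l = 4 * (l %/ 4) + l %% 4 by lia.
have odd4 a c : odd (4 * a + c) = odd c by rewrite oddD oddM.
move: (ltn_pmod l (isT : 0 < 4)); move: (l %/ 4) (l %% 4) => p r r4 ->.
rewrite /odd_part_formula t_tm; have [T0 T1 T2 T3] := tm_quad p.
rewrite odd4; case: r r4 => [|[|[|[|//]]]] _; rewrite ?addn0 ?T0 ?T1 ?T2 ?T3 /=;
  case: i i4 => [|[|[|[|//]]]] _; case: (tm_sqr p) => -> /=;
  case=> // _ _; rewrite ?expr0 ?expr1 ?exprS; lia.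
Qed.

Lemma odd_part_formula_ex i p : i < 4 ->
  exists2 l, exceptional i (tm l) (odd l) & odd_part_formula i p = Posz l.*2.+1.
Proof.
move=> i4; have [T0 T1 T2 T3] := tm_quad p.
suff [r r4 Er] : exists2 r, r < 4 & exceptional i (tm (4 * p + r)) (odd (4 * p + r)).
  exists (4 * p + r) => //.
  rewrite -(odd_part_formulaP i4 Er); congr odd_part_formula; lia.
case: i i4 => [|[|[|[|//]]]] _; case: (tm_sqr p) => E.
- by exists 2 => //; rewrite T2 E oddD oddM.
- by exists 0 => //; rewrite addn0 T0 E oddM.
- by exists 0 => //; rewrite addn0 T0 E oddM.
- by exists 2 => //; rewrite T2 E oddD oddM.
- by exists 3 => //; rewrite T3 E oddD oddM.
- by exists 1 => //; rewrite T1 E oddD oddM.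
- by exists 1 => //; rewrite T1 E oddD oddM.
- by exists 3 => //; rewrite T3 E oddD oddM.
Qed.

Lemma odd_part_ex q : 0 < q -> exists v l, q = expn 2 v * l.*2.+1.
Proof.
elim/ltn_ind: q => q IH q0; case: (boolP (odd q)) => oq.
  by exists 0, q./2; rewrite mul1n -divn2; lia.
have [v [l E]] := IH q./2 ltac:(rewrite -divn2; lia) ltac:(rewrite -divn2; lia).
by exists v.+1, l; rewrite expnS -mulnA -E -divn2; lia.
Qed.

(** The values 1, 3, 9, 19 below index 4, which [model] does not cover, are sums of three
    squares. *)
Lemma in_S_ge4 n : in_S 3 n -> 4 <= n.
Proof.
move=> /in_S_sum3 H; rewrite leqNgt; apply/negP => n4; apply: H.
have b3 : bz 3 = 19%Z by rewrite bz_rec /= bz0 bz1 bz2.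
case: n n4 => [|[|[|[|//]]]] _; rewrite ?bz0 ?bz1 ?bz2 ?b3.
- by exists 1%Z, 0%Z, 0%Z.
- by exists 1%Z, 1%Z, 1%Z.
- by exists 3%Z, 0%Z, 0%Z.
- by exists 3%Z, 3%Z, 1%Z.
Qed.

Lemma Posz_expn2 k : (2%:Z ^+ k)%R = Posz (expn 2 k).
Proof. by elim: k => // k IH; rewrite exprS expnS IH PoszM. Qed.

End Parametrization.

Theorem theorem4p2 (n : nat) :
  in_S 3 n <->
  exists (i : 'I_4) (k p : nat),
    (0 < k)%N /\
    (n%:Z = 2%:Z ^+ (2 * k + 1)%N *
              ((8 * p)%:Z + 2%:Z * (i %/ 2)%N%:Z + 3%:Z
               + 2%:Z * (-1) ^+ (i : nat) * t p)
            + (i : nat)%:Z)%R.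
Proof.
split=> [nS | [i [k [p [k0 E]]]]].
  have n4 := in_S_ge4 nS.
  have q0 : (0 < n %/ 4)%N by rewrite divn_gt0.
  have [v [l qE]] := odd_part_ex q0.
  have i4 : n %% 4 < 4 by rewrite ltn_pmod.
  have nE : n = 4 * (expn 2 v * l.*2.+1) + n %% 4 by rewrite -qE; lia.
  move: nS; rewrite {1}nE => /(in_S_classified v l i4) [ov ex].
  (* As v is odd, v = 2 k - 1 for this k > 0, and 4 * 2^v = 2^(2 k + 1). *)
  exists (Ordinal i4), v./2.+1, (l %/ 4); split=> //.
  rewrite -[X in (_ * X)%R]/(odd_part_formula (n %% 4) (l %/ 4)) odd_part_formulaP //.
  rewrite Posz_expn2 {1}nE /= PoszD mulnA PoszM; congr (_ * _ + _)%R.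
  have -> : 2 * v./2.+1 + 1 = v.+2 by rewrite -divn2; lia.
  by rewrite !expnS mulnA.
have [l ex lE] := odd_part_formula_ex p (ltn_ord i).
have nE : n = 4 * (expn 2 (2 * k - 1) * l.*2.+1) + i.
  move: E; rewrite -[X in (_ * X)%R]/(odd_part_formula i p) lE Posz_expn2.
  rewrite -PoszM -PoszD => -[->]; rewrite mulnA; congr (_ * _ + _).
  have -> : 2 * k + 1 = (2 * k - 1).+2 by lia.
  by rewrite !expnS mulnA.
rewrite nE; apply/in_S_classified => //; split=> //.
by lia.
Qed.
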